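(* Suppose that $f$ has at least one saddle-point. Suppose that for every $k\in\mathbf{N}$, $\lambda_k=\theta_k\le1$, with $\lambda_0=\theta_0=1$, and that for every $k\in\mathbf{N}$, $\tau_{k+1}\ge\frac{\tau_k}{\theta_{k+1}(1+\mu_1\tau_k)}$ and $\sigma_{k+1}\ge\frac{\sigma_k}{\theta_{k+1}(1+\mu_2\sigma_k)}$. Suppose that $\tau_k=\sigma_k$ for every $k\in\mathbf{N}$ and that $\lim_{k\to\infty}\tau_k=\lim_{k\to\infty}\sigma_k\in\mathbf{R}_{++}$. Let $(\alpha_k)_{k\in\mathbf{N}}$, $(\beta_k)_{k\in\mathbf{N}}$, $(\gamma_k)_{k\in\mathbf{N}}$, $(\delta_k)_{k\in\mathbf{N}}$ be sequences in $\mathbf{R}_{++}$ such that $$\eta_x:=1-\sup_{k\in\mathbf{N}}\tau_k\left(L_{xx}\sup_{k\in\mathbf{N}}\lambda_k\alpha_k+L_{xy}\sup_{k\in\mathbf{N}}\lambda_k\beta_k+\frac{L_{xx}}{\inf_{k\in\mathbf{N}}\alpha_k}+\frac{L_{yx}}{\inf_{k\in\mathbf{N}}\gamma_k}\right)\in\mathbf{R}_{++}$$ and $$\eta_y:=1-\sup_{k\in\mathbf{N}}\sigma_k\left(L_{yx}\sup_{k\in\mathbf{N}}\theta_k\gamma_k+L_{yy}\sup_{k\in\mathbf{N}}\theta_k\delta_k+\frac{L_{xy}}{\inf_{k\in\mathbf{N}}\beta_k}+\frac{L_{yy}}{\inf_{k\in\mathbf{N}}\delta_k}\right)\in\mathbf{R}_{++}.$$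 Then the iteration sequence $((x^k,y^k))_{k\in\mathbf{N}}$ converges weakly to a saddle-point of $f$.
   Context: $\mathbf{N}=\{0,1,2,\dots\}$, $\mathbf{R}_+=[0,\infty)$, $\mathbf{R}_{++}=(0,\infty)$; $\mathcal{H}_1,\mathcal{H}_2$ are real Hilbert spaces. Problem. $\Phi:\mathcal{H}_1\times\mathcal{H}_2\to\mathbf{R}\cup\{\pm\infty\}$, $f_i:\mathcal{H}_i\to\mathbf{R}\cup\{+\infty\}$ ($i=1,2$), and $f(x,y)=f_1(x)+\Phi(x,y)-f_2(y)$, with the convention $+\infty-(+\infty)=-\infty$; so $f(x,y)=f_1(x)+\Phi(x,y)-f_2(y)\in\mathbf{R}$ if $x\in\operatorname{dom}f_1$ and $y\in\operatorname{dom}f_2$; $f(x,y)=-\infty$ if $y\notin\operatorname{dom}f_2$; $f(x,y)=+\infty$ if $x\notin\operatorname{dom}f_1$ and $y\in\operatorname{dom}f_2$. Standing assumptions: each $f_i$ is proper, lower semicontinuous, and convex with modulus $\mu_i\ge0$ (i.e. $f_i-\frac{\mu_i}{2}\|\cdot\|^2$ is convex); $\operatorname{dom}f_1,\operatorname{dom}f_2$ are nonempty, closed and convex; for every $y\in\operatorname{dom}f_2$, $\Phi(\cdot,y):\mathcal{H}_1\to\mathbf{R}$ is convex and Fréchet differentiable (gradient $\nabla_x\Phi$); for every $x\in\operatorname{dom}f_1$, $\Phi(x,\cdot):\mathcal{H}_2\to\mathbf{R}$ is concave and Fréchet differentiable (gradient $\nabla_y\Phi$); there are $L_{xx},L_{xy},L_{yx},L_{yy}\in\mathbf{R}_+$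 such that for all $(x,y),(x',y')\in\operatorname{dom}f_1\times\operatorname{dom}f_2$, $\|\nabla_x\Phi(x,y)-\nabla_x\Phi(x',y')\|\le L_{xx}\|x-x'\|+L_{xy}\|y-y'\|$ and $\|\nabla_y\Phi(x,y)-\nabla_y\Phi(x',y')\|\le L_{yx}\|x-x'\|+L_{yy}\|y-y'\|$. Saddle-point: $(x^{*},y^{*})\in\mathcal{H}_1\times\mathcal{H}_2$ with $f(x^{*},y)\le f(x^{*},y^{*})\le f(x,y^{*})$ for all $(x,y)\in\mathcal{H}_1\times\mathcal{H}_2$ (necessarily $(x^*,y^* )\in\operatorname{dom}f_1\times\operatorname{dom}f_2$). Algorithm. $(x^0,y^0)\in\operatorname{dom}f_1\times\operatorname{dom}f_2$, $x^{-1}=x^0$, $y^{-1}=y^0$; $(\tau_k),(\sigma_k),(\lambda_k),(\theta_k)$ ($k\in\mathbf{N}$) are sequences in $\mathbf{R}_{++}$; for every $k\in\mathbf{N}$, $x^{k+1}=\operatorname{Prox}_{\tau_kf_1}\big(x^k-\tau_k((1+\lambda_k)\nabla_x\Phi(x^k,y^k)-\lambda_k\nabla_x\Phi(x^{k-1},y^{k-1}))\big)$, $y^{k+1}=\operatorname{Prox}_{\sigma_kf_2}\big(y^k+\sigma_k((1+\theta_k)\nabla_y\Phi(x^k,y^k)-\theta_k\nabla_y\Phi(x^{k-1},y^{k-1}))\big)$, where $\operatorname{Prox}_{g}(u)=\operatorname{argmin}_z\,g(z)+\frac12\|z-u\|^2$. All iterates lie in $\operatorname{dom}f_1\times\operatorname{dom}f_2$.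 Suprema and infima are taken in $[0,+\infty]$ with $\frac10=+\infty$, $\frac{1}{+\infty}=0$, $0\cdot(+\infty)=0$. *)

(* Defs.v *)
From HB Require Import structures.
From mathcomp Require Import all_boot all_order all_algebra.
From mathcomp Require Import sesquilinear.
From mathcomp Require Import all_classical all_reals all_analysis.

Set Implicit Arguments.
Unset Strict Implicit.
Unset Printing Implicit Defensive.

Import Order.TTheory GRing.Theory Num.Theory.
Import numFieldNormedType.Exports.

Local Open Scope classical_set_scope.
Local Open Scope ring_scope.

HB.mixin Record CompleteNormedModule_isHilbert (R : realType) H
    & CompleteNormedModule R H := {
  inner : {dot H for (@idfun R)} ;
  inner_norm : forall x : H, inner x x = `|x| ^+ 2
}.

#[short(type="hilbertType")]
HB.structure Definition Hilbert (R : realType) :=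
  {H of CompleteNormedModule R H & CompleteNormedModule_isHilbert R H}.

(* The library's product [V * W] carries the max norm. It is equivalent to the
   norm of the Hilbert direct sum, so both have the same continuous linear
   functionals and hence the same weak convergence. *)
Definition weakly_cvg (R : realType) (V : normedModType R)
    (u : nat -> V) (l : V) : Prop :=
  forall phi : {linear V -> R^o}, continuous phi ->
    phi (u n) @[n --> \oo] --> phi l.

Section ExtendedRealFunctions.
Context {R : realType} {H : hilbertType R}.
Local Open Scope ereal_scope.

Definition edom (g : H -> \bar R) : set H := [set x | g x < +oo].

Definition proper_efun (g : H -> \bar R) : Prop :=
  (forall x, g x != -oo) /\ edom g !=set0.

Definition econvex (g : H -> \bar R) : Prop :=
  forall (x y : H) (t : R), (0 <= t <= 1)%R ->
    g (t *: x + (1 - t) *: y)%R <= t%:E * g x + (1 - t)%:E * g y.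

Definition convex_with_modulus (mu : R) (g : H -> \bar R) : Prop :=
  econvex (fun x => g x - (mu / 2 * `|x| ^+ 2)%:E).

Definition argmin (g : H -> \bar R) : H :=
  get [set p | forall z, g p <= g z].

Definition prox (g : H -> \bar R) (u : H) : H :=
  argmin (fun z => g z + (2^-1 * `|z - u| ^+ 2)%:E).

End ExtendedRealFunctions.

(* Riesz representative of the Frechet differential. *)
Definition gradient (R : realType) (H : hilbertType R)
    (g : H -> R) (x : H) : H :=
  get [set v | forall h, 'd g x h = inner v h].

Section SaddleFunction.
Context {R : realType} {H1 H2 : hilbertType R}.
Local Open Scope ereal_scope.

(* The partial gradients are only meaningful where the corresponding slice of
   [Phi] is real-valued. *)
Definition gradx (Phi : H1 -> H2 -> \bar R) (x : H1) (y : H2) : H1 :=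
  gradient (fun x' => fine (Phi x' y)) x.

Definition grady (Phi : H1 -> H2 -> \bar R) (x : H1) (y : H2) : H2 :=
  gradient (fun y' => fine (Phi x y')) y.

(* In [\bar R], [-oo] is absorbing for the addition, which is the convention
   +oo - (+oo) = -oo. *)
Definition objective (f1 : H1 -> \bar R) (Phi : H1 -> H2 -> \bar R)
    (f2 : H2 -> \bar R) (x : H1) (y : H2) : \bar R :=
  f1 x + Phi x y - f2 y.

Definition saddle_point (f : H1 -> H2 -> \bar R) (z : H1 * H2) : Prop :=
  forall x y, f z.1 y <= f z.1 z.2 /\ f z.1 z.2 <= f x z.2.

End SaddleFunction.

Definition esup (R : realType) (u : nat -> R) : \bar R :=
  ereal_sup (range (fun k => (u k)%:E)).

Definition einf (R : realType) (u : nat -> R) : \bar R :=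
  ereal_inf (range (fun k => (u k)%:E)).

(* Main.v *)
(* Each step of the algorithm is a proximal inequality; combining the two with
   the convexity of Phi gives, for (u, v) in dom f1 x dom f2, a one-step
   estimate of f(x^{k+1}, v) - f(u, y^{k+1}). When (u, v) is a saddle point this
   gap is nonnegative, and Young's inequality for the extrapolation terms turns
   the estimate into the descent of
     V_k = (|x^k - u|^2 + |y^k - v|^2) / (2 tau_k) - theta_k I_k
           + theta_k (bx |x^k - x^{k-1}|^2 + by |y^k - y^{k-1}|^2) / 2,
   where I_k pairs the last gradient increments with (x^k - u, y^k - v). Hence
   the iterates are bounded, the increments vanish and |x^k - u|^2 + |y^k - v|^2
   converges. For arbitrary (u, v) the estimate bounds the gap by a null
   sequence, so weak lower semicontinuity makes every weak cluster point a
   saddle point, and Opial's argument applies. Weak cluster points come from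
   ultrafilters on nat: a bounded sequence has a weak limit along any
   ultrafilter, by compactness of segments and Riesz' theorem. The existence of
   proximal points, Riesz' theorem and projections onto closed convex sets are
   all instances of the minimization of a strongly convex function. *)
Require Import Defs.
From HB Require Import structures.
From mathcomp Require Import all_boot all_order all_algebra.
From mathcomp Require Import sesquilinear.
From mathcomp Require Import all_classical all_reals all_analysis.
From mathcomp Require Import ring lra.

Set Implicit Arguments.
Unset Strict Implicit.
Unset Printing Implicit Defensive.

Import Order.TTheory GRing.Theory Num.Theory.
Import numFieldNormedType.Exports.

Local Open Scope classical_set_scope.
Local Open Scope ring_scope.

(** * Inner products *)

Section InnerProduct.
Context {R : realType} {H : hilbertType R}.
Implicit Types (u v w : H) (a : R).

Lemma innerDl w u v : inner (u + v) w = inner u w + inner v w.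
Proof. exact: linearDl. Qed.

Lemma innerDr w u v : inner w (u + v) = inner w u + inner w v.
Proof. exact: linearDr. Qed.

Lemma innerNl w u : inner (- u) w = - inner u w.
Proof. exact: linearNl. Qed.

Lemma innerNr w u : inner w (- u) = - inner w u.
Proof. exact: linearNr. Qed.

Lemma innerZl w a u : inner (a *: u) w = a * inner u w.
Proof. exact: linearZl_LR. Qed.

Lemma innerZr w a u : inner w (a *: u) = a * inner w u.
Proof. exact: linearZr. Qed.

Lemma innerC u v : inner u v = inner v u.
Proof. by rewrite (@hermC _ _ _ _ (@inner R H))/= expr0 mul1r. Qed.

Definition innerE := (innerDl, innerDr, innerNl, innerNr, innerZl, innerZr).

Lemma normDsq u v : `|u + v| ^+ 2 = `|u| ^+ 2 + 2 * inner u v + `|v| ^+ 2.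
Proof. rewrite -!inner_norm !innerE (innerC v u); ring. Qed.

Lemma normBsq u v : `|u - v| ^+ 2 = `|u| ^+ 2 - 2 * inner u v + `|v| ^+ 2.
Proof. by rewrite normDsq innerNr normrN mulrN. Qed.

(** Cauchy-Schwarz: for unit vectors, expand [|a - b|^2 >= 0]; then rescale. Replacing [u] by [- u]
    gives the absolute value. *)
Lemma inner_norm_le u v : `|inner u v| <= `|u| * `|v|.
Proof.
have le1 (a b : H) : `|a| = 1 -> `|b| = 1 -> inner a b <= 1.
  move=> a1 b1; have := sqr_ge0 `|a - b|; rewrite normBsq a1 b1; lra.
have [->|u0] := eqVneq u 0; first by rewrite -(scale0r 0) innerZl mul0r normr0 mulr_ge0.
have [->|v0] := eqVneq v 0; first by rewrite -(scale0r 0) innerZr mul0r normr0 mulr_ge0.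
have nu w : w != 0 -> `| `|w|^-1 *: w| = 1.
  by move=> w0; rewrite normrZ normfV normr_id mulVf// normr_eq0.
have main (a b : H) : a != 0 -> b != 0 -> inner a b <= `|a| * `|b|.
  move=> a0 b0; have := le1 _ _ (nu _ a0) (nu _ b0); rewrite !innerE mulrA.
  by rewrite -invfM mulrC ler_pdivrMr ?mul1r ?mulr_gt0 ?normr_gt0// mulrC.
rewrite ler_norml main// andbT lerNl -innerNl -[in leRHS](normrN u) main//.
by rewrite oppr_eq0.
Qed.

End InnerProduct.

(** * Minimization of strongly convex functions *)

(* [lra] fails on hypotheses about extended reals. *)
Ltac elra := repeat match goal with
  | h : is_true (_ <= _)%E |- _ => clear h
  | h : is_true (_ < _)%E |- _ => clear h
  | h : _ = _ :> \bar _ |- _ => clear h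
  | h : is_true (~~ (_ == _ :> \bar _)) |- _ => clear h
  end; lra.

(* Convexity with modulus expressed on real upper bounds, which avoids
   arithmetic with infinite values. *)
Definition epi_convex {R : realType} {H : hilbertType R} (m : R)
    (g : H -> \bar R) : Prop :=
  forall u v a b t, 0 <= t <= 1 -> (g u <= a%:E)%E -> (g v <= b%:E)%E ->
  (g (t *: u + (1 - t) *: v)%R <=
    (t * a + (1 - t) * b - m / 2 * (t * (1 - t) * `|u - v| ^+ 2))%:E)%E.

Section StronglyConvex.
Context {R : realType} {H : hilbertType R}.
Variables (m : R) (g : H -> \bar R).
Hypotheses (gNy : forall z, g z != -oo%E) (glsc : lower_semicontinuous g)
  (gcvx : epi_convex m g) (m0 : 0 < m).

(** Lower semicontinuity bounds [g] below on a ball around [p0]. A point outside is pulled along the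
    segment towards [p0] into that ball, and the quadratic term of strong convexity then bounds its
    own value below. *)
Lemma strongly_convex_lbound p0 a0 : g p0 = a0%:E ->
  exists c, forall z b, (g z <= b%:E)%E -> c <= b.
Proof.
move=> gp0; have : ((a0 - 1)%:E < g p0)%E by rewrite gp0 lte_fin; elra.
move=> /glsc[V /nbhs_ballP[e /= e0 eV] VP].
pose d := e / 2; have d0 : 0 < d by rewrite divr_gt0.
have c0 : 0 < 4 / (m * d ^+ 2) by rewrite divr_gt0// mulr_gt0// exprn_gt0.
have ballP z : `|z - p0| <= d -> ((a0 - 1)%:E < g z)%E.
  move=> zd; apply/VP/eV; rewrite -ball_normE/= distrC.
  by apply: le_lt_trans zd _; rewrite /d; elra.
(* For [z] at distance [r > d] the argument gives [b - a0 > (2 r / d) (m d r / 8 - 1)], and the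
   minimum of the right side over [r] is [- 4 / (m d^2)]. The further [- 1] covers the ball. *)
exists (a0 - 1 - 4 / (m * d ^+ 2)) => z b gzb.
have [zd|zd] := leP `|z - p0| d.
  by have := lt_le_trans (ballP _ zd) gzb; rewrite lte_fin; elra.
set r := `|z - p0| in zd *.
have r0 : 0 < r by exact: lt_trans zd.
pose t := d / (2 * r).
have tr : t * r = d / 2 by rewrite /t; field; elra.
have t0 : 0 < t by rewrite divr_gt0// mulr_gt0.
have t1 : t <= 1 / 2.
  by rewrite /t ler_pdivrMr ?mulr_gt0//; elra.
pose w := t *: z + (1 - t) *: p0.
have wE : w - p0 = t *: (z - p0).
  by rewrite /w scalerBl scale1r scalerBr [p0 - _]addrC addrA addrK.
have /ballP gw : `|w - p0| <= d.
  by rewrite wE normrZ gtr0_norm// tr; elra.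
have : (g w <= (t * b + (1 - t) * a0 - m / 2 * (t * (1 - t) * r ^+ 2))%:E)%E.
  by apply: gcvx; rewrite ?gp0//; elra.
move=> /(lt_le_trans gw); rewrite lte_fin.
have -> : t * (1 - t) * r ^+ 2 = (t * r) * r * (1 - t) by ring.
rewrite tr => h.
have q0 : 0 < m * d * r by rewrite !mulr_gt0.
have h1 : t * (b - a0) > -1 + m * d * r / 8.
  have : m * d * r * (1 - t) >= m * d * r / 2 by rewrite ler_pM2l//; elra.
  by elra.
have h2 : t * (4 / (m * d ^+ 2)) = 2 / (m * d * r).
  by rewrite /t; field; rewrite !gt_eqF.
have h3 : 0 <= m * d * r / 8 + 2 / (m * d * r) - 1.
  have -> : m * d * r / 8 + 2 / (m * d * r) - 1 =
            (m * d * r - 4) ^+ 2 / (8 * (m * d * r)) by field; rewrite !gt_eqF.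
  by rewrite divr_ge0 ?sqr_ge0// mulr_ge0// ltW.
have : 0 < t * (b - a0 + 4 / (m * d ^+ 2)) by rewrite mulrDr h2; elra.
by rewrite pmulr_rgt0//; elra.
Qed.

(** A minimizing sequence is Cauchy, because the value at the midpoint of two of its terms is at
    least the infimum. Its limit is a minimizer by lower semicontinuity. *)
Lemma strongly_convex_argmin : edom g !=set0 -> exists p, forall z, (g p <= g z)%E.
Proof.
case=> p0 gp0y.
have [a0 gp0] : exists a0, g p0 = a0%:E.
  by exists (fine (g p0)); rewrite fineK// fin_numE gNy/= lt_eqF.
have [c cP] := strongly_convex_lbound gp0.
pose E := [set b : R | exists z, (g z <= b%:E)%E].
have hE : has_inf E.
  split; first by exists a0, p0; rewrite gp0.
  by exists c => b [z] /cP.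
pose I := inf E.
have Ile z b : (g z <= b%:E)%E -> I <= b.
  by move=> gb; apply: ge_inf; [case: hE|exists z].
have /choice[z zP] : forall n : nat, exists z, (g z <= (I + n.+1%:R^-1)%:E)%E.
  move=> n; have n0 : 0 < n.+1%:R^-1 :> R by rewrite invr_gt0.
  have [b [z gz] bI] := inf_adherent n0 hE.
  by exists z; apply: le_trans gz _; rewrite lee_fin ltW.
have zC i j : `|z i - z j| ^+ 2 <= 4 / m * (i.+1%:R^-1 + j.+1%:R^-1).
  have h01 : 0 <= (2^-1 : R) <= 1 by elra.
  have := Ile _ _ (gcvx h01 (zP i) (zP j)).
  set A := `|z i - z j| ^+ 2 => h; rewrite mulrAC ler_pdivlMr//; move: h.
  by set x1 := i.+1%:R^-1; set x2 := j.+1%:R^-1; elra.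
have zcvg : cvg (z @ \oo).
  apply/cauchy_cvgP/cauchy_exP => e e0.
  have : (n.+1%:R^-1 : R) @[n --> \oo] --> (0 : R) by exact: cvg_harmonic.
  move=> /cvgrPdist_lt /(_ (m * e ^+ 2 / 8)); case.
    by rewrite !divr_gt0 ?mulr_gt0 ?exprn_gt0.
  move=> N _ NP; exists (z N); exists N => //= k /= Nk; rewrite -ball_normE/=.
  rewrite -(@ltr_pXn2r _ 2)// ?nnegrE ?normr_ge0 ?(ltW e0)//.
  apply: le_lt_trans (zC _ _) _.
  have := NP _ (leqnn N); have := NP _ Nk => /=.
  rewrite !sub0r !normrN !ger0_norm ?invr_ge0//.
  set x1 := N.+1%:R^-1; set x2 := k.+1%:R^-1 => h1 h2.
  by rewrite mulrAC ltr_pdivrMr//; elra.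
pose p := lim (z @ \oo).
have zp : z @ \oo --> p by exact: zcvg.
have gpI : (g p <= I%:E)%E.
  rewrite leNgt; apply/negP => Igp.
  have [a Ia agp] : exists2 a, I < a & (a%:E < g p)%E.
    case E1 : (g p) Igp => [r| |]//; rewrite ?lte_fin => Ir.
      by exists ((I + r) / 2); rewrite ?lte_fin; elra.
    by exists (I + 1); rewrite ?ltry//; elra.
  have [V pV VP] := glsc agp.
  have hV : \forall n \near \oo, V (z n) by exact: zp.
  have aI0 : 0 < a - I by elra.
  have : (n.+1%:R^-1 : R) @[n --> \oo] --> (0 : R) by exact: cvg_harmonic.
  move=> /cvgrPdist_lt /(_ _ aI0) hn.
  have [n [Vn]] := filter_ex (filterI hV hn).
  rewrite /= sub0r normrN ger0_norm ?invr_ge0//.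
  by have := lt_le_trans (VP _ Vn) (zP n); rewrite lte_fin; set x1 := n.+1%:R^-1; elra.
exists p => w; apply: le_trans gpI _.
case E1 : (g w) => [r| |]; rewrite ?leey//; last by have := gNy w; rewrite E1.
by rewrite lee_fin; apply: (Ile w); rewrite E1.
Qed.

(** Compare [p] with [t z + (1 - t) p], divide by [t] and let [t] tend to 0. One small explicit [t]
    replaces the limit. *)
Lemma strongly_convex_growth p : edom g !=set0 -> (forall z, (g p <= g z)%E) ->
  g p \is a fin_num /\
  forall z a, (g z <= a%:E)%E -> fine (g p) + m / 2 * `|z - p| ^+ 2 <= a.
Proof.
move=> [p0 gp0] pmin.
have gpf : g p \is a fin_num.
  by rewrite fin_numE gNy/= lt_eqF//; exact: le_lt_trans (pmin p0) gp0.
split=> // z a gza.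
rewrite leNgt; apply/negP.
set r := `|z - p| ^+ 2 => ha.
have h t : 0 < t <= 1 -> fine (g p) + m / 2 * ((1 - t) * r) <= a.
  move=> /andP[t0 t1].
  have gpp : (g p <= (fine (g p))%:E)%E by rewrite fineK.
  have t01 : 0 <= t <= 1 by rewrite (ltW t0).
  have := le_trans (pmin _) (gcvx t01 gza gpp).
  rewrite -[in X in (X <= _)%E](fineK gpf) lee_fin -/r => hh.
  have : 0 <= t * (a - fine (g p) - m / 2 * ((1 - t) * r)) by elra.
  by rewrite pmulr_rge0//; elra.
have h1 : 0 <= a - fine (g p) by have := h 1; rewrite subrr mul0r mulr0; elra.
have r0 : 0 < m * r by elra.
(* Half the value of [t] at which [h] would be an equality under [ha], so that [h] at [s] is
   contradictory. *)
pose s := (m / 2 * r - (a - fine (g p))) / (m * r).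
have s0 : 0 < s by rewrite divr_gt0//; elra.
have s1 : s <= 1 by rewrite ler_pdivrMr//; elra.
have := h _ (introT andP (conj s0 s1)).
have : s * (m * r) = m / 2 * r - (a - fine (g p)) by rewrite /s divfK ?gt_eqF.
nra.
Qed.

End StronglyConvex.

(** * Proximal points, Riesz' theorem and gradients *)

Section Prox.
Context {R : realType} {H : hilbertType R}.
Implicit Types (g f : H -> \bar R) (h : H -> R).

Lemma normsq_conv (u v : H) (t : R) : `|t *: u + (1 - t) *: v| ^+ 2 =
  t * `|u| ^+ 2 + (1 - t) * `|v| ^+ 2 - t * (1 - t) * `|u - v| ^+ 2.
Proof.
rewrite !normDsq !innerE normrN !normrZ !exprMn !real_normK ?num_real//; ring.
Qed.

(** The modulus term is the exact convexity defect of the squared norm, given by [normsq_conv]. *)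
Lemma epi_convexW mu g : (forall z, g z != -oo%E) -> convex_with_modulus mu g ->
  epi_convex mu g.
Proof.
move=> gNy gcvx u v a b t t01 gua gvb.
have fin z c : (g z <= c%:E)%E -> g z = (fine (g z))%:E.
  by move=> gz; rewrite fineK// fin_numE gNy/= lt_eqF// (le_lt_trans gz)// ltry.
have := gcvx u v t t01; rewrite (fin _ _ gua) (fin _ _ gvb).
have {}gua : fine (g u) <= a by rewrite -lee_fin -(fin _ _ gua).
have {}gvb : fine (g v) <= b by rewrite -lee_fin -(fin _ _ gvb).
rewrite leeBlDr// => /le_trans; apply.
rewrite -!EFinB -!EFinM -!EFinD lee_fin.
have [t0 t1] : 0 <= t /\ 0 <= 1 - t by lra.
have ta : t * fine (g u) <= t * a by rewrite ler_wpM2l.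
have tb : (1 - t) * fine (g v) <= (1 - t) * b by rewrite ler_wpM2l.
rewrite normsq_conv; elra.
Qed.

Lemma epi_convexZ mu g tau : 0 < tau -> epi_convex mu g ->
  epi_convex (tau * mu) (fun z => tau%:E * g z)%E.
Proof.
move=> tau0 gcvx u v a b t t01.
rewrite -!lee_pdivlMl// -!EFinM => gu gv.
apply: le_trans (gcvx _ _ _ _ _ t01 gu gv) _.
by rewrite lee_fin le_eqVlt; apply/orP; left; apply/eqP; field; rewrite gt_eqF.
Qed.

Lemma epi_convexD mu nu g h : epi_convex mu g -> epi_convex nu (EFin \o h) ->
  epi_convex (mu + nu) (fun z => g z + (h z)%:E)%E.
Proof.
move=> gcvx hcvx u v a b t t01.
rewrite -!leeBrDr// -!EFinB => gu gv.
apply: le_trans (gcvx _ _ _ _ _ t01 gu gv) _.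
have := hcvx _ _ _ _ _ t01 (lexx (h u)%:E) (lexx (h v)%:E).
by rewrite !lee_fin => hc; lra.
Qed.

Lemma epi_convex_sqdist (c : R) (u : H) :
  epi_convex c (fun z : H => (c / 2 * `|z - u| ^+ 2)%:E).
Proof.
move=> z w a b t t01; rewrite !lee_fin => za wb.
have [t0 t1] : 0 <= t /\ 0 <= 1 - t by lra.
have ta : t * (c / 2 * `|z - u| ^+ 2) <= t * a by rewrite ler_wpM2l.
have tb : (1 - t) * (c / 2 * `|w - u| ^+ 2) <= (1 - t) * b by rewrite ler_wpM2l.
have -> : t *: z + (1 - t) *: w - u = t *: (z - u) + (1 - t) *: (w - u).
  rewrite !scalerBr addrACA -opprD -scalerDl; congr (_ - _).
  by rewrite addrC subrK scale1r.
have -> : z - w = (z - u) - (w - u) by rewrite opprB addrA subrK.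
set p := z - u in ta *; set q := w - u in tb *.
rewrite normsq_conv; lra.
Qed.

Lemma lower_semicontinuousZ g tau : 0 < tau -> lower_semicontinuous g ->
  lower_semicontinuous (fun z => tau%:E * g z)%E.
Proof.
move=> tau0 glsc z a; rewrite -lte_pdivrMl// -EFinM => /glsc[V zV VP].
by exists V => // w /VP; rewrite EFinM lte_pdivrMl.
Qed.

Lemma lower_semicontinuousD g h : lower_semicontinuous g -> continuous h ->
  lower_semicontinuous (fun z => g z + (h z)%:E)%E.
Proof.
move=> glsc hc z a; rewrite -lteBlDr// -EFinB => agz.
have [b ab bgz] : exists2 b, a - h z < b & (b%:E < g z)%E.
  case E1 : (g z) agz => [r| |]//; rewrite ?lte_fin => ar.
    by exists ((a - h z + r) / 2); rewrite ?lte_fin; elra.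
  by exists (a - h z + 1); rewrite ?ltry//; elra.
have [V zV VP] := glsc _ _ bgz.
have hb : \forall w \near z, a - b < h w.
  by apply: cvgr_gt (hc z) _ _; rewrite ltrBlDr addrC -ltrBlDr.
exists (V `&` [set w | a - b < h w]); first exact: filterI.
move=> w [/VP bw /= abw]; rewrite -lteBlDr// -EFinB; apply: lt_trans bw.
by rewrite lte_fin; elra.
Qed.

Lemma continuous_sqdist (c : R) (u : H) :
  continuous (fun z : H => c * `|z - u| ^+ 2 : R).
Proof.
move=> z; apply: cvgM; first exact: cvg_cst.
by apply: cvgM; apply: cvg_norm; apply: cvgB => //; exact: cvg_cst.
Qed.

(** The function minimized by [prox] is strongly convex with modulus [tau * mu + 1]. Hence a
    minimizer exists, [get] returns one, and quadratic growth around it is the proximal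
    inequality. *)
Lemma prox_growth (mu : R) f (tau : R) u : 0 <= mu -> 0 < tau -> proper_efun f ->
  lower_semicontinuous f -> convex_with_modulus mu f ->
  let p := prox (fun z => tau%:E * f z)%E u in
  f p \is a fin_num /\
  forall z a, (f z <= a%:E)%E ->
    tau * fine (f p) + 2^-1 * `|p - u| ^+ 2 + (tau * mu + 1) / 2 * `|z - p| ^+ 2
    <= tau * a + 2^-1 * `|z - u| ^+ 2.
Proof.
move=> mu0 tau0 [fNy [z0 fz0]] flsc /(epi_convexW fNy) fcvx p.
pose G z := (tau%:E * f z + (2^-1 * `|z - u| ^+ 2)%:E)%E.
have half : (2^-1 : R) = 1 / 2 by rewrite div1r.
have Gcvx : epi_convex (tau * mu + 1) G.
  apply: epi_convexD; first exact: epi_convexZ.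
  by rewrite half; exact: epi_convex_sqdist.
have Glsc : lower_semicontinuous G.
  apply: lower_semicontinuousD; last exact: continuous_sqdist.
  exact: lower_semicontinuousZ.
have GNy z : G z != -oo%E.
  rewrite /G; have := fNy z; case: (f z) => [r| |]// _.
  by rewrite gt0_muley// lte_fin.
have G0 : edom G !=set0.
  exists z0; rewrite /edom/= /G; move: fz0; rewrite /edom/=.
  have := fNy z0; case: (f z0) => [r| |]// _ _.
  by rewrite -EFinM -EFinD ltry.
have m0 : 0 < tau * mu + 1 by rewrite ltr_wpDl// mulr_ge0// ltW.
have pmin : forall z, (G p <= G z)%E.
  have := strongly_convex_argmin GNy Glsc Gcvx m0 G0.
  exact: (@getPex _ [set p | forall z, (G p <= G z)%E]).
have [Gp Gg] := strongly_convex_growth GNy Gcvx G0 pmin.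
have fp : f p \is a fin_num.
  by move: Gp; rewrite /G fin_numD => /andP[+ _]; have := fNy p;
     case: (f p) => [r| |]//; rewrite gt0_muley// lte_fin.
split=> // z a fza.
have /Gg : (G z <= (tau * a + 2^-1 * `|z - u| ^+ 2)%:E)%E.
  by rewrite /G EFinD leeD2r// EFinM lee_pmul2l// lte_fin.
by rewrite /G -(fineK fp) -EFinM -EFinD/=.
Qed.

(** The representative is the minimizer [p] of [|z|^2 / 2 - phi z]: quadratic growth at [p + h]
    reads [phi h <= inner p h], and [- h] gives the converse. *)
Lemma riesz (phi : {linear H -> R^o}) : continuous phi ->
  exists v, forall w, phi w = inner v w.
Proof.
move=> phic.
pose G z := ((1 / 2 * `|z - 0| ^+ 2)%:E + (- phi z)%:E)%E.
have Gcvx : epi_convex (1 + 0) G.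
  apply: epi_convexD; first exact: epi_convex_sqdist.
  move=> u v a b t t01; rewrite /= !lee_fin => ua vb.
  have [t0 t1] : 0 <= t /\ 0 <= 1 - t by lra.
  have ta : t * (- phi u) <= t * a by rewrite ler_wpM2l.
  have tb : (1 - t) * (- phi v) <= (1 - t) * b by rewrite ler_wpM2l.
  rewrite linearD !linearZ /=; rewrite /GRing.scale/=; lra.
have Glsc : lower_semicontinuous G.
  apply: lower_semicontinuousD; last first.
    by move=> z; apply: cvgN; exact: phic.
  move=> z a; rewrite lte_fin => az.
  exists [set w | a < 1 / 2 * `|w - 0| ^+ 2] => //.
  by apply: cvgr_gt az; exact: continuous_sqdist.
have GNy z : G z != -oo%E by [].
have G0 : edom G !=set0 by exists 0; rewrite /edom/= /G -EFinD ltry.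
have m0 : 0 < 1 + 0 :> R by lra.
have [p pmin] := strongly_convex_argmin GNy Glsc Gcvx m0 G0.
have [_ Gg] := strongly_convex_growth GNy Gcvx G0 pmin.
have le (h : H) : phi h <= inner p h.
  have := Gg (p + h) _ (lexx _); rewrite /G -!EFinD /= !subr0.
  rewrite [p + h - p]addrC addKr linearD normDsq; lra.
exists p => w; apply/le_anti; rewrite le/=.
by have := le (- w); rewrite linearN innerNr lerN2.
Qed.

(** The differential is continuous, so [riesz] shows that the set from which [get] chooses is
    nonempty. *)
Lemma gradientE (g : H -> R) x (h : H) : differentiable g x ->
  'd g x h = inner (gradient g x) h.
Proof.
move=> gd; have [v vP] := riesz (diff_continuous gd).
rewrite /gradient; set P := (X in get X).
by have /getPex/(_ h) : exists w, P w by exists v.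
Qed.

Lemma convex_function_le (g : H -> R) u v (t : R) : convex_function setT g ->
  0 <= t <= 1 -> g (t *: u + (1 - t) *: v) <= t * g u + (1 - t) * g v.
Proof.
move=> gcvx /andP[t0 t1].
by have := gcvx (Itv01 t0 t1) u v; rewrite !inE => /(_ I I).
Qed.

Lemma convex_function_epi (g : H -> R) : convex_function setT g ->
  epi_convex 0 (EFin \o g).
Proof.
move=> gcvx u v a b t t01; rewrite /= !lee_fin => ua vb.
have [t0 t1] : 0 <= t /\ 0 <= 1 - t by lra.
have ta : t * g u <= t * a by rewrite ler_wpM2l.
have tb : (1 - t) * g v <= (1 - t) * b by rewrite ler_wpM2l.
by have := convex_function_le u v gcvx t01; lra.
Qed.

(** By convexity the difference quotients towards [z] with step [t] in []0, 1]] are at most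
    [g z - g x]; the directional derivative is their limit from the right. *)
Lemma convex_diff_le (g : H -> R) x z : convex_function setT g ->
  differentiable g x -> g x + 'd g x (z - x) <= g z.
Proof.
move=> gcvx gd; rewrite -lerBrDl -deriveE//.
have /cvg_dnbhs_at_right := @diff_derivable _ _ _ _ _ (z - x) gd.
rewrite -/(derive g x (z - x)) => /cvgr_to_le; apply.
near=> t.
have t0 : 0 < t by near: t; exact: nbhs_right_gt.
have t1 : t <= 1 by near: t; exact: nbhs_right_le.
rewrite /GRing.scale/= mulrC ler_pdivrMr//.
have -> : t *: (z - x) + x = t *: z + (1 - t) *: x.
  by rewrite scalerBr scalerBl scale1r -addrA; congr (_ + _); rewrite addrC.
rewrite lerBlDr; have : 0 <= t <= 1 by rewrite (ltW t0).
by move=> /(convex_function_le z x gcvx)/le_trans; apply; lra.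
Unshelve. all: by end_near. Qed.

Lemma convex_gradient_le (g : H -> R) x z : convex_function setT g ->
  differentiable g x -> g x + inner (gradient g x) (z - x) <= g z.
Proof. by move=> gcvx gd; rewrite -gradientE//; exact: convex_diff_le. Qed.

Lemma concave_gradient_ge (g : H -> R) x z :
  convex_function setT (fun w => - g w) -> differentiable g x ->
  g z <= g x + inner (gradient g x) (z - x).
Proof.
move=> gcvx gd.
have := @convex_diff_le (fun w => - g w) x z gcvx (differentiableN gd).
have -> : 'd (fun w => - g w) x (z - x) = - inner (gradient g x) (z - x).
  by rewrite -gradientE// (@diffN _ _ _ g x gd).
by lra.
Qed.

(** [A1] is free here and will be the gradient at the new point. Writing the extrapolated gradient
    as [A1 - (A1 - A0) + theta (A0 - Am)] yields pairings of the same shape at consecutive steps,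
    which the Lyapunov function telescopes. *)
Lemma prox_step (mu tau theta a : R) f (p x0 A0 Am A1 u : H) :
  0 <= mu -> 0 < tau -> proper_efun f ->
  lower_semicontinuous f -> convex_with_modulus mu f ->
  p = prox (fun z => tau%:E * f z)%E
        (x0 - tau *: ((1 + theta) *: A0 - theta *: Am)) ->
  (f u <= a%:E)%E ->
  tau * (fine (f p) - a) + (1 + mu * tau) / 2 * `|p - u| ^+ 2
  + 2^-1 * `|p - x0| ^+ 2
  + tau * inner A1 (p - u) - tau * inner (A1 - A0) (p - u)
  + tau * theta * inner (A0 - Am) (x0 - u)
  + tau * theta * inner (A0 - Am) (p - x0) <= 2^-1 * `|x0 - u| ^+ 2.
Proof.
move=> mu0 tau0 fproper flsc fcvx pE fua.
set w := (1 + theta) *: A0 - theta *: Am in pE.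
have [_ /(_ _ _ fua)] := prox_growth (x0 - tau *: w) mu0 tau0 fproper flsc fcvx.
rewrite -pE (distrC u p).
have -> : p - (x0 - tau *: w) = (p - x0) + tau *: w by rewrite opprB addrA addrAC.
have -> : u - (x0 - tau *: w) = tau *: w - (x0 - u).
  by rewrite !opprB [LHS]addrC -addrA addrCA addrC -addrA addrCA addrA addrC.
have -> : inner A1 (p - u) = inner A1 (p - x0) + inner A1 (x0 - u).
  by rewrite -innerDr addrA subrK.
have -> : inner (A1 - A0) (p - u) =
    inner (A1 - A0) (p - x0) + inner (A1 - A0) (x0 - u).
  by rewrite -innerDr addrA subrK.
set d := p - x0; set e := x0 - u.
rewrite (normDsq d) (normBsq (tau *: w)) (innerC d) /w.
rewrite !innerDl !innerNl !innerZl !innerDl !innerNl !innerZl => h.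
lra.
Qed.

(** An ascent step is a descent step for the negated gradients. *)
Lemma prox_step_ascent (mu tau theta a : R) f (p x0 B0 Bm B1 u : H) :
  0 <= mu -> 0 < tau -> proper_efun f ->
  lower_semicontinuous f -> convex_with_modulus mu f ->
  p = prox (fun z => tau%:E * f z)%E
        (x0 + tau *: ((1 + theta) *: B0 - theta *: Bm)) ->
  (f u <= a%:E)%E ->
  tau * (fine (f p) - a) + (1 + mu * tau) / 2 * `|p - u| ^+ 2
  + 2^-1 * `|p - x0| ^+ 2
  - tau * inner B1 (p - u) + tau * inner (B1 - B0) (p - u)
  - tau * theta * inner (B0 - Bm) (x0 - u)
  - tau * theta * inner (B0 - Bm) (p - x0) <= 2^-1 * `|x0 - u| ^+ 2.
Proof.
move=> mu0 tau0 fproper flsc fcvx pE fua.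
have innerNB b c w : inner (- b - - c : H) w = - inner (b - c) w.
  by rewrite -opprD innerNl.
have := @prox_step mu tau theta a f p x0 (- B0) (- Bm) (- B1) u mu0 tau0 fproper
  flsc fcvx _ fua.
rewrite !innerNB innerNl !mulrN opprK; apply.
by rewrite pE !scalerN -opprD scalerN opprK.
Qed.

End Prox.

(** * Weak convergence *)

(** An arbitrary filter is allowed because cluster points are taken along ultrafilters. By [riesz]
    the maps [inner w] are all the continuous linear functionals. *)
Definition filter_wcvg {R : realType} {H : hilbertType R} {T : Type}
    (F : set_system T) (u : T -> H) (l : H) : Prop :=
  forall w, inner w (u t) @[t --> F] --> inner w l.

Section WeakConvergence.
Context {R : realType} {H : hilbertType R}.

(** Half the squared distance to [x], set to [+oo] off [C], is strongly convex with modulus 1.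
    Quadratic growth at its minimizer is, after expanding the square, the obtuse angle condition. *)
Lemma closed_convex_projection (C : set H) x : closed C -> C !=set0 ->
  (forall u v t, C u -> C v -> 0 <= t <= 1 -> C (t *: u + (1 - t) *: v)) ->
  exists2 p, C p & forall z, C z -> inner (x - p) (z - p) <= 0.
Proof.
move=> clC [c0 Cc0] cvxC.
pose g z := if `[< C z >] then (1 / 2 * `|z - x| ^+ 2)%:E else +oo%E.
have gC z : C z -> g z = (1 / 2 * `|z - x| ^+ 2)%:E by move=> Cz; rewrite /g asboolT.
have gNC z : ~ C z -> g z = +oo%E by move=> Cz; rewrite /g asboolF.
have gfin z a : (g z <= a%:E)%E -> C z.
  by rewrite /g; case: asboolP => //; rewrite leye_eq.
have gNy z : g z != -oo%E by rewrite /g; case: asboolP.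
have gcvx : epi_convex 1 g.
  move=> u v a b t t01 gua gvb.
  have [Cu Cv] := (gfin _ _ gua, gfin _ _ gvb).
  move: gua gvb; rewrite !gC//; last exact: cvxC.
  by move=> gua gvb; exact: epi_convex_sqdist.
have glsc : lower_semicontinuous g.
  move=> z a agz; exists [set w | (a%:E < g w)%E] => //.
  have [Cz|Cz] := pselect (C z); last first.
    have : nbhs z (~` C) by apply: open_nbhs_nbhs; split => //; exact: closed_openC.
    by apply: filterS => w Cw; rewrite /= gNC// ltry.
  move: agz; rewrite gC// lte_fin => az.
  have : \forall w \near z, a < 1 / 2 * `|w - x| ^+ 2.
    by apply: cvgr_gt az; exact: continuous_sqdist.
  apply: filterS => w aw /=; rewrite /g; case: asboolP => _; last exact: ltry.
  by rewrite lte_fin.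
have g0 : edom g !=set0 by exists c0; rewrite /edom/= gC// ltry.
have [p pmin] := strongly_convex_argmin gNy glsc gcvx ltr01 g0.
have [gp gg] := strongly_convex_growth gNy gcvx g0 pmin.
have Cp : C p by apply: (gfin p (fine (g p))); rewrite fineK.
exists p => // z Cz.
have := gg z (1 / 2 * `|z - x| ^+ 2); rewrite !gC// lexx => /(_ isT)/=.
have -> : z - x = (z - p) - (x - p) by rewrite opprB addrA subrK.
by rewrite (normBsq (z - p)) (innerC (z - p)) (distrC p); lra.
Qed.

(** The sublevel set at [a] is closed and convex and misses [l]. The projection of [l] onto it gives
    a half-space containing the sublevel set, and [u t] eventually leaves that half-space. *)
Lemma weak_lower_semicontinuous {T} (F : set_system T) {FF : ProperFilter F}
    (g : H -> \bar R) (u : T -> H) l (a : R) :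
  epi_convex 0 g -> lower_semicontinuous g -> filter_wcvg F u l ->
  (a%:E < g l)%E -> \forall t \near F, (a%:E < g (u t))%E.
Proof.
move=> gcvx glsc ul agl.
pose C := [set z | (g z <= a%:E)%E].
have clC : closed C.
  rewrite (_ : C = ~` [set z | (a%:E < g z)%E]).
    by apply: open_closedC; have [+ _] := lower_semicontinuousP g; exact.
  by apply/seteqP; split => z /=; rewrite /C /= leNgt => /negP.
have [[c Cc]|C0] := pselect (C !=set0); last first.
  apply: nearW => t; rewrite ltNge; apply/negP => gt.
  by apply: C0; exists (u t).
have [p Cp pP] : exists2 p, C p & forall z, C z -> inner (l - p) (z - p) <= 0.
  apply: closed_convex_projection => //; first by exists c.
  move=> v w t Cv Cw t01; rewrite /C/=.
  by apply: le_trans (gcvx _ _ _ _ _ t01 Cv Cw) _; rewrite lee_fin; elra.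
have lp : inner (l - p) p < inner (l - p) l.
  rewrite -subr_gt0 -innerNr -innerDr inner_norm exprn_gt0// normr_gt0 subr_eq0.
  by apply: contraTneq agl => ->; rewrite -leNgt.
have : \forall t \near F, inner (l - p) p < inner (l - p) (u t).
  by apply: cvgr_gt lp; exact: ul.
apply: filterS => t h.
rewrite ltNge; apply/negP => /pP; rewrite innerDr innerNr; elra.
Qed.

(** Compactness of the segment gives a cluster point, and a cluster point of an ultrafilter is a
    limit: otherwise the complement of a neighbourhood would belong to it. *)
Lemma bounded_ultra_cvg {T} (F : set_system T) {FU : UltraFilter F}
    (f : T -> R) (M : R) : (forall t, `|f t| <= M) ->
  exists2 l, f @ F --> l & `|l| <= M.
Proof.
move=> fM.
have [|l [/= lM lF]] := @segment_compact R (- M) M (f @ F) _.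
  by apply: nearW => t /=; rewrite in_itv/= -ler_norml.
exists l; last by move: lM; rewrite in_itv/= -ler_norml.
move=> B lB; have [//|nB] := in_ultra_setVsetC (f @^-1` B) FU.
by have [t []] := lF (~` B) B nB lB.
Qed.

(** The limits of [inner w (u t)] along the ultrafilter form a bounded linear functional of [w],
    whose Riesz representative is the weak limit. *)
Lemma bounded_ultra_wcvg {T} (F : set_system T) {FU : UltraFilter F}
    (u : T -> H) (M : R) : (forall t, `|u t| <= M) ->
  exists l, filter_wcvg F u l.
Proof.
move=> uM.
have /choice[L LP] w : exists l, inner w (u t) @[t --> F] --> l /\ `|l| <= `|w| * M.
  have [|l lF lM] := @bounded_ultra_cvg T F _ (fun t => inner w (u t)) (`|w| * M).
    move=> t; apply: le_trans (inner_norm_le _ _) _.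
    by rewrite ler_wpM2l.
  by exists l.
have Llin : linear (L : H -> R^o).
  move=> a v w; apply: (@cvg_unique _ _ (inner (a *: v + w) (u t) @[t --> F])) => //.
    by have [] := LP (a *: v + w).
  have -> : (fun t => inner (a *: v + w) (u t)) =
      (fun t => a * inner v (u t) + inner w (u t)).
    by apply/funext => t; rewrite innerDl innerZl.
  by apply: cvgD; [apply: cvgMr|]; have [] := LP v; have [] := LP w.
pose Lc : {linear H -> R^o} := HB.pack L (GRing.isLinear.Build R H R^o _ L Llin).
have Lle v : `|L v| <= `|v| * M by have [] := LP v.
have M0 : 0 <= M.
  have [t _] := @filter_ex _ F _ setT filterT.
  exact: le_trans (normr_ge0 _) (uM t).
have Lcont : continuous Lc.
  move=> v; apply/cvgrPdist_lt => e e0.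
  have e1 : 0 < e / (M + 1) by rewrite divr_gt0// ltr_wpDl.
  have /cvgrPdist_lt/(_ _ e1) : id @ nbhs v --> v by [].
  apply: filterS => w; rewrite ltr_pdivlMr ?ltr_wpDl// => h.
  rewrite -linearB; apply: le_lt_trans (Lle _) _; apply: le_lt_trans h.
  by rewrite ler_wpM2l//; lra.
have [l lP] := riesz Lcont.
exists l => w; have [+ _] := LP w.
by rewrite (innerC w) -lP.
Qed.

End WeakConvergence.

(** * Functionals on the product space and Opial's argument *)

Section Opial.
Context {R : realType} {H1 H2 : hilbertType R}.

(** The product with the max norm is not itself a [hilbertType], so [riesz] is applied to the
    restriction of [phi] to each factor. *)
Lemma linear_pair_inner (phi : {linear (H1 * H2)%type -> R^o}) : continuous phi ->
  exists v1 v2, forall z, phi z = inner v1 z.1 + inner v2 z.2.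
Proof.
move=> phic.
have lin1 : linear (fun u : H1 => phi (u, 0) : R^o).
  by move=> a u v; rewrite -linearP; congr (phi _); apply: injective_projections => /=;
     rewrite ?scaler0 ?addr0.
have lin2 : linear (fun v : H2 => phi (0, v) : R^o).
  by move=> a u v; rewrite -linearP; congr (phi _); apply: injective_projections => /=;
     rewrite ?scaler0 ?addr0.
pose phi1 : {linear H1 -> R^o} :=
  HB.pack (fun u => phi (u, 0)) (GRing.isLinear.Build R H1 R^o _ _ lin1).
pose phi2 : {linear H2 -> R^o} :=
  HB.pack (fun u => phi (0, u)) (GRing.isLinear.Build R H2 R^o _ _ lin2).
have [|v1 v1P] := @riesz _ _ phi1.
  move=> u; apply: (@continuous_comp _ _ _ (fun u => (u, 0)) phi); last exact: phic.
  by apply: cvg_pair => //=; exact: cvg_cst.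
have [|v2 v2P] := @riesz _ _ phi2.
  move=> u; apply: (@continuous_comp _ _ _ (fun u => (0, u)) phi); last exact: phic.
  by apply: cvg_pair => //=; exact: cvg_cst.
exists v1, v2 => -[u v] /=; rewrite -v1P -v2P /=.
rewrite -[in RHS](linearD phi); congr (phi _).
by apply: injective_projections; rewrite /= ?addr0 ?add0r.
Qed.

(* Opial: any two weak cluster points z, z' lying in S coincide, because
   <z_k, z - z'> converges as a difference of squared distances to S. *)
Lemma opial (x : nat -> H1) (y : nat -> H2) (S : H1 * H2 -> Prop) (M : R) :
  (forall k, `|x k| <= M) -> (forall k, `|y k| <= M) ->
  (forall z, S z -> cvg (`|x k - z.1| ^+ 2 + `|y k - z.2| ^+ 2 @[k --> \oo])) ->
  (forall (F : set_system nat), ProperFilter F -> \oo `<=` F ->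
    forall z, filter_wcvg F x z.1 -> filter_wcvg F y z.2 -> S z) ->
  exists2 z, S z & weakly_cvg (fun k => (x k, y k)) z.
Proof.
move=> xM yM Scvg Sclus.
have ultra (F : set_system nat) : ProperFilter F -> \oo `<=` F ->
    exists G z, [/\ UltraFilter G, F `<=` G, S z,
      filter_wcvg G x z.1 & filter_wcvg G y z.2].
  move=> FF Foo; have [G [GU FG]] := ultraFilterLemma FF.
  have [l1 xl1] := bounded_ultra_wcvg xM; have [l2 yl2] := bounded_ultra_wcvg yM.
  exists G, (l1, l2); split => //.
  by apply: (Sclus G _ _ (l1, l2)) => //; exact: subset_trans FG.
have [U [z [UU ooU Sz xz yz]]] := ultra \oo _ (fun _ => id).
exists z => // phi phic.
have [v1 [v2 phiE]] := linear_pair_inner phic.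
apply/cvgrPdist_lt => e e0; apply: contrapT => nB.
pose B := [set k | `|phi z - phi (x k, y k)| < e].
(* If [phi] does not converge to [phi z], the bad indices meet every tail. A weak cluster point [z']
   is then extracted along bad indices only; once [z = z'] is known, this is contradictory. *)
have PF : ProperFilter (within (~` B) \oo).
  apply: Build_ProperFilter => -/= h; apply: nB.
  have : \forall k \near \oo, (~` B) k -> set0 k by exact: h.
  by apply: filterS => k /= hk; apply: contrapT => /hk.
have [G [z' [GU FG Sz' xz' yz']]] := ultra _ PF (@cvg_within _ _ _ _).
have ooG : \oo `<=` G by apply: subset_trans FG; exact: cvg_within.
have [d dP] : exists d,
    (fun k => inner (z.1 - z'.1) (x k) + inner (z.2 - z'.2) (y k)) @ \oo --> (d : R).
  eexists.
  have -> : (fun k => inner (z.1 - z'.1) (x k) + inner (z.2 - z'.2) (y k)) =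
      (fun k => (`|z.1| ^+ 2 + `|z.2| ^+ 2 - (`|z'.1| ^+ 2 + `|z'.2| ^+ 2)
        - ((`|x k - z.1| ^+ 2 + `|y k - z.2| ^+ 2) -
         (`|x k - z'.1| ^+ 2 + `|y k - z'.2| ^+ 2))) / 2).
    apply/funext => k; rewrite !normBsq !innerE.
    by rewrite (innerC z.1) (innerC z.2) (innerC z'.1) (innerC z'.2); lra.
  apply: cvgMl; apply: cvgB; first exact: cvg_cst.
  by apply: cvgB; [exact: Scvg Sz|exact: Scvg Sz'].
have zz' : z = z'.
  (* The convergent sequence has the same limit [d] along both ultrafilters. Comparing its values at
     [z] and [z'] gives squared distance 0 between them. *)
  have lim (F : set_system nat) w : ProperFilter F -> \oo `<=` F ->
      filter_wcvg F x w.1 -> filter_wcvg F y w.2 ->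
      inner (z.1 - z'.1) w.1 + inner (z.2 - z'.2) w.2 = d.
    move=> FF Foo xw yw.
    apply: (@cvg_unique _ _
      ((fun k => inner (z.1 - z'.1) (x k) + inner (z.2 - z'.2) (y k)) @ F)) => //.
      by apply: cvgD.
    by apply: cvg_trans dP; exact: cvg_app.
  have e1 := lim _ _ (@ultra_proper _ _ UU) ooU xz yz.
  have e2 := lim _ _ (@ultra_proper _ _ GU) ooG xz' yz'.
  have : `|z.1 - z'.1| ^+ 2 + `|z.2 - z'.2| ^+ 2 = 0.
    by rewrite -!inner_norm !(innerDr _ z.1) !(innerDr _ z.2) !innerNr; lra.
  move=> /eqP; rewrite paddr_eq0 ?sqr_ge0// !sqrf_eq0 !normr_eq0 !subr_eq0.
  by rewrite -xpair_eqE -!surjective_pairing => /eqP.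
subst z'.
have phiG : phi (x k, y k) @[k --> G] --> phi z.
  have -> : (fun k => phi (x k, y k)) = (fun k => inner v1 (x k) + inner v2 (y k)).
    by apply/funext => k; rewrite phiE.
  by rewrite phiE; apply: cvgD.
have GB : G B by move/cvgrPdist_lt : phiG => /(_ _ e0).
have GnB : G (~` B) by apply: FG; apply: withinT.
by have [k []] := filter_ex (filterI GB GnB).
Qed.

End Opial.

(** * Saddle points *)

Section SaddlePoints.
Context {R : realType} {H1 H2 : hilbertType R}.
Variables (Phi : H1 -> H2 -> \bar R) (f1 : H1 -> \bar R) (f2 : H2 -> \bar R).
Hypotheses (f1_proper : proper_efun f1) (f2_proper : proper_efun f2)
  (Phix_fin : forall u v, v \in edom f2 -> Phi u v \is a fin_num).

Lemma edom_fin {H : hilbertType R} (g : H -> \bar R) u :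
  proper_efun g -> u \in edom g -> g u = (fine (g u))%:E.
Proof.
by move=> [gNy _]; rewrite inE /edom/= => gu; rewrite fineK// fin_numE gNy lt_eqF.
Qed.

Lemma notin_edom {H : hilbertType R} (g : H -> \bar R) u :
  u \notin edom g -> g u = +oo%E.
Proof.
by rewrite notin_setE /edom/= => /negP; rewrite -leNgt leye_eq => /eqP.
Qed.

Let L u v : R := fine (f1 u) + fine (Phi u v) - fine (f2 v).

Let objective_fin u v : u \in edom f1 -> v \in edom f2 ->
  objective f1 Phi f2 u v = (L u v)%:E.
Proof.
move=> u1 v2; rewrite /objective (edom_fin f1_proper u1) (edom_fin f2_proper v2).
by rewrite -(fineK (Phix_fin u v2)).
Qed.

(** Infinite values force [z] into the domains: off [dom f2] the value at [z] would be [-oo], off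
    [dom f1] it would be [+oo], each against a comparison with [u0], [v0]. On the domains the two
    inequalities merge into one, and [v = z.2] or [u = z.1] recovers each. *)
Lemma saddle_pointP z : saddle_point (objective f1 Phi f2) z <->
  [/\ z.1 \in edom f1, z.2 \in edom f2 &
    forall u v, u \in edom f1 -> v \in edom f2 ->
    fine (f1 z.1) + fine (Phi z.1 v) - fine (f2 v) <=
    fine (f1 u) + fine (Phi u z.2) - fine (f2 z.2)].
Proof.
have [f1N [u0 u0dom]] := f1_proper; have [f2N [v0 v0dom]] := f2_proper.
move: u0dom v0dom => /mem_set u0dom /mem_set v0dom.
split=> [zS|[z1 z2 zS] u v].
- have z2 : z.2 \in edom f2.
    apply: contraT => z2; have [+ _] := zS u0 v0.
    rewrite {2}/objective (notin_edom z2) addeNy leeNy_eq.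
    rewrite /objective (edom_fin f2_proper v0dom).
    rewrite -(fineK (Phix_fin z.1 v0dom)).
    by have := f1N z.1; case: (f1 z.1).
  have z1 : z.1 \in edom f1.
    apply: contraT => z1; have [_] := zS u0 v0.
    rewrite (objective_fin u0dom z2) /objective (notin_edom z1).
    rewrite (edom_fin f2_proper z2) -(fineK (Phix_fin z.1 z2)).
    by rewrite leye_eq.
  split=> // u v u1 v2; have [+ +] := zS u v.
  by move=> /le_trans/[apply]; rewrite !objective_fin.
- split.
    have [v2|v2] := boolP (v \in edom f2).
      by rewrite !objective_fin// lee_fin; exact: zS.
    by rewrite /objective (notin_edom v2) addeNy leNye.
  have [u1|u1] := boolP (u \in edom f1).
    by rewrite !objective_fin// lee_fin; exact: zS.
  rewrite {2}/objective (notin_edom u1) (edom_fin f2_proper z2).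
  by rewrite -(fineK (Phix_fin u z2)) leey.
Qed.

End SaddlePoints.

(** Weak lower semicontinuity only supplies real numbers strictly below each summand. This turns
    them into a bound on the sum before the summands are known to be finite. *)
Lemma adde_le_fin {R : realType} (e1 e2 : \bar R) (c : R) :
  e1 != -oo%E -> e2 != -oo%E ->
  (forall a1 a2 : R, (a1%:E < e1)%E -> (a2%:E < e2)%E -> a1 + a2 <= c) ->
  (e1 + e2 <= c%:E)%E.
Proof.
have below (e : \bar R) : e != -oo%E -> exists a : R, (a%:E < e)%E.
  case: e => [r| |]// _; last by exists 0; exact: ltry.
  by exists (r - 1); rewrite lte_fin; elra.
case: e1 => [r1| |]// e1N; case: e2 => [r2| |]// e2N h.
- rewrite -EFinD lee_fin leNgt; apply/negP => cr.
  pose e := (r1 + r2 - c) / 3.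
  by have := h (r1 - e) (r2 - e); rewrite !lte_fin /e; elra.
- have [a ar] := below r1%:E e1N.
  by exfalso; have := h a (c - a + 1) ar (ltry _); elra.
- have [a ar] := below r2%:E e2N.
  by exfalso; have := h (c - a + 1) a (ltry _) ar; elra.
- by exfalso; have := h (c + 1) 0 (ltry _) (ltry _); elra.
Qed.

(** * Real constants from extended suprema and infima *)

Lemma le_esup {R : realType} (u : nat -> R) k : ((u k)%:E <= esup u)%E.
Proof. by apply: ereal_sup_ubound; exists k. Qed.

Lemma einf_le {R : realType} (u : nat -> R) k : (einf u <= (u k)%:E)%E.
Proof. by apply: ereal_inf_lbound; exists k. Qed.

Lemma le_mul_esup {R : realType} (L : R) (u : nat -> R) k : 0 <= L ->
  ((L * u k)%:E <= L%:E * esup u)%E.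
Proof. by move=> L0; rewrite EFinM lee_wpmul2l// ?lee_fin// le_esup. Qed.

Lemma le_div_einf {R : realType} (L : R) (u : nat -> R) k : 0 <= L ->
  (forall j, 0 < u j) -> ((L / u k)%:E <= L%:E / einf u)%E.
Proof.
move=> L0 u0; rewrite EFinM lee_wpmul2l ?lee_fin//.
have i0 : (0 <= einf u)%E.
  by apply: le_ereal_inf_tmp => _ [j _ <-]; rewrite lee_fin ltW.
have := einf_le u k.
case: (einf u) i0 => [r| |]//; rewrite ?lee_fin => r0.
move=> ru; rewrite inver; case: ifPn => [_|r1]; first exact: leey.
by rewrite lee_fin lef_pV2// posrE// lt_neqAle eq_sym r1.
Qed.

(** The supremum of [tau] is positive, so an infinite bracket would make the margin [-oo]; hence the
    bracket is finite. Its first two terms give [a], its last two give [b], and the margin itself is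
    [eta]. The supremum of [tau] may still be infinite when the bracket is 0. *)
Lemma step_size_constants {R : realType} (L1 L2 L3 L4 : R)
    (tau p q al be : nat -> R) :
  0 <= L1 -> 0 <= L2 -> 0 <= L3 -> 0 <= L4 ->
  (forall k, 0 < tau k) -> (forall k, 0 < p k) -> (forall k, 0 < q k) ->
  (forall k, 0 < al k) -> (forall k, 0 < be k) ->
  (0 < 1 - esup tau * (L1%:E * esup p + L2%:E * esup q
                       + L3%:E / einf al + L4%:E / einf be))%E ->
  exists a b eta : R, [/\ 0 < eta,
    forall k, L1 * p k + L2 * q k <= a,
    forall k, L3 / al k + L4 / be k <= b &
    forall k, tau k * (a + b) <= 1 - eta].
Proof.
move=> L10 L20 L30 L40 tau0 p0 q0 al0 be0.
have ge0 (e : \bar R) (r : R) : 0 <= r -> (r%:E <= e)%E -> (0 <= e)%E.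
  by move=> r0; apply: le_trans; rewrite lee_fin.
have h1 k := le_mul_esup p k L10; have h2 k := le_mul_esup q k L20.
have h3 k := le_div_einf k L30 al0; have h4 k := le_div_einf k L40 be0.
have := ge0 _ _ (mulr_ge0 L10 (ltW (p0 0%N))) (h1 0%N).
have := ge0 _ _ (mulr_ge0 L20 (ltW (q0 0%N))) (h2 0%N).
have := ge0 _ _ (divr_ge0 L30 (ltW (al0 0%N))) (h3 0%N).
have := ge0 _ _ (divr_ge0 L40 (ltW (be0 0%N))) (h4 0%N).
have hT := le_esup tau.
move: h1 h2 h3 h4 hT.
move: (L1%:E * _)%E (L2%:E * _)%E (L3%:E / _)%E (L4%:E / _)%E (esup tau).
move=> s1 s2 s3 s4 T h1 h2 h3 h4 hT s40 s30 s20 s10.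
have T0 : (0 < T)%E by apply: lt_le_trans (hT 0%N); rewrite lte_fin.
set S := (s1 + s2 + s3 + s4)%E => h.
have S0 : (0 <= S)%E by rewrite !adde_ge0.
have Sy : (S < +oo)%E.
  rewrite ltey; apply/eqP => Sy; move: h; rewrite Sy gt0_muley// addeNy.
have [r1 r2 r3 r4] : [/\ s1 \is a fin_num, s2 \is a fin_num,
    s3 \is a fin_num & s4 \is a fin_num].
  by move: Sy; rewrite /S -ge0_fin_numE// !fin_numD => /andP[/andP[/andP[-> ->] ->] ->].
have TS : (T * S)%E \is a fin_num.
  rewrite ge0_fin_numE; last by rewrite mule_ge0// ltW.
  by rewrite ltey; apply/eqP => E; move: h; rewrite E addeNy ltNge leNye.
exists (fine s1 + fine s2), (fine s3 + fine s4), (1 - fine (T * S)%E).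
have SE : (fine s1 + fine s2 + (fine s3 + fine s4))%:E = S.
  by rewrite /S addrA !EFinD !fineK.
split.
- by rewrite -lte_fin EFinB fineK.
- move=> k; apply: lerD; rewrite -lee_fin fineK//.
- move=> k; apply: lerD; rewrite -lee_fin fineK//.
- move=> k; rewrite subKr -lee_fin fineK// EFinM SE.
  by rewrite lee_wpmul2r.
Qed.

(** * The Lyapunov function *)

Lemma young {R : realType} (L d w c : R) : 0 <= L -> 0 < c ->
  L * d * w <= (L * c * w ^+ 2 + L / c * d ^+ 2) / 2.
Proof.
move=> L0 c0; rewrite -subr_ge0.
have -> : (L * c * w ^+ 2 + L / c * d ^+ 2) / 2 - L * d * w =
          L * (c * w - d) ^+ 2 / (2 * c) by field; rewrite gt_eqF.
by rewrite divr_ge0// mulr_ge0 ?sqr_ge0// ltW.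
Qed.

(** Young's inequality is applied to each of the four products, with weights [al], [be], [ga], [de].
    The factor [th] is absorbed into [ax] and [ay] but kept in front of the squares of [d1] and
    [d2]. *)
Lemma weighted_young {R : realType}
    (L11 L12 L21 L22 al be ga de th ax ay bx by_ d1 d2 w1 w2 i1 i2 : R) :
  0 <= L11 -> 0 <= L12 -> 0 <= L21 -> 0 <= L22 -> 0 <= th ->
  0 < al -> 0 < be -> 0 < ga -> 0 < de ->
  L11 * (th * al) + L12 * (th * be) <= ax ->
  L21 * (th * ga) + L22 * (th * de) <= ay ->
  L11 / al + L21 / ga <= bx -> L12 / be + L22 / de <= by_ ->
  i1 <= (L11 * d1 + L12 * d2) * w1 -> i2 <= (L21 * d1 + L22 * d2) * w2 ->
  th * (i1 + i2) <=
    (ax * w1 ^+ 2 + ay * w2 ^+ 2 + th * (bx * d1 ^+ 2 + by_ * d2 ^+ 2)) / 2.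
Proof.
move=> L110 L120 L210 L220 th0 al0 be0 ga0 de0 hax hay hbx hby h1 h2.
have y1 := young d1 w1 L110 al0; have y2 := young d2 w1 L120 be0.
have y3 := young d1 w2 L210 ga0; have y4 := young d2 w2 L220 de0.
have b1 : (L11 / al + L21 / ga) * d1 ^+ 2 <= bx * d1 ^+ 2.
  by rewrite ler_wpM2r// sqr_ge0.
have b2 : (L12 / be + L22 / de) * d2 ^+ 2 <= by_ * d2 ^+ 2.
  by rewrite ler_wpM2r// sqr_ge0.
have a1 : (L11 * (th * al) + L12 * (th * be)) * w1 ^+ 2 <= ax * w1 ^+ 2.
  by rewrite ler_wpM2r// sqr_ge0.
have a2 : (L21 * (th * ga) + L22 * (th * de)) * w2 ^+ 2 <= ay * w2 ^+ 2.
  by rewrite ler_wpM2r// sqr_ge0.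
have : i1 + i2 <= ((L11 * al + L12 * be) * w1 ^+ 2 + (L21 * ga + L22 * de) * w2 ^+ 2
  + (bx * d1 ^+ 2 + by_ * d2 ^+ 2)) / 2 by lra.
by move=> /(ler_wpM2l th0)/le_trans; apply; lra.
Qed.

Section Lyapunov.
Context {R : realType}.
Variables (tau theta X Y Dx Dy I J gap : nat -> R).
Variables (mu1 mu2 ax bx ay by_ T eta : R).
Hypotheses (tau_gt0 : forall k, 0 < tau k) (tau_le : forall k, tau k <= T)
  (theta_gt0 : forall k, 0 < theta k) (theta_le1 : forall k, theta k <= 1)
  (tau_step1 : forall k, tau k <= tau k.+1 * (theta k.+1 * (1 + mu1 * tau k)))
  (tau_step2 : forall k, tau k <= tau k.+1 * (theta k.+1 * (1 + mu2 * tau k))).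
Hypotheses (X_ge0 : forall k, 0 <= X k) (Y_ge0 : forall k, 0 <= Y k)
  (Dx_ge0 : forall k, 0 <= Dx k) (Dy_ge0 : forall k, 0 <= Dy k).
Hypotheses (bx_ge0 : 0 <= bx) (by_ge0 : 0 <= by_) (eta_gt0 : 0 < eta)
  (eta_x : forall k, tau k * (ax + bx) <= 1 - eta)
  (eta_y : forall k, tau k * (ay + by_) <= 1 - eta).
Hypotheses
  (J_le : forall k, - (theta k * J k) <=
    (ax * Dx k.+1 + ay * Dy k.+1 + theta k * (bx * Dx k + by_ * Dy k)) / 2)
  (I_le : forall k, theta k * I k <=
    (ax * X k + ay * Y k + theta k * (bx * Dx k + by_ * Dy k)) / 2)
  (gap_ge0 : forall k, 0 <= gap k.+1)
  (step : forall k,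
    tau k * gap k.+1 + (1 + mu1 * tau k) / 2 * X k.+1
    + (1 + mu2 * tau k) / 2 * Y k.+1 + (Dx k.+1 + Dy k.+1) / 2
    - tau k * I k.+1
    <= (X k + Y k) / 2 - tau k * theta k * I k - tau k * theta k * J k).

(** In the application [X], [Y] are squared distances to a saddle point, [Dx], [Dy] squared
    increments, and [I], [J] pair gradient increments with distances and with next increments. The
    last summand is what [I_le] and [J_le] charge to the current increments. *)
Definition lyapunov k := (X k + Y k) / (2 * tau k) - theta k * I k
  + theta k * (bx * Dx k + by_ * Dy k) / 2.

Let T_gt0 : 0 < T.
Proof. exact: lt_le_trans (tau_gt0 0%N) (tau_le 0%N). Qed.

(** Makes the surplus of [1 / tau k] over the weights uniform in [k]. *)
Let slack k a b : tau k * (a + b) <= 1 - eta -> eta / T <= (tau k)^-1 - a - b.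
Proof.
move=> h; have t0 := tau_gt0 k; have tT := tau_le k.
have : eta / T <= eta / tau k by rewrite ler_pM2l// lef_pV2.
have : a + b <= (1 - eta) / tau k by rewrite ler_pdivlMr// mulrC.
by rewrite mulrBl mul1r; lra.
Qed.

Let lyapunovE k : lyapunov k = (tau k)^-1 * (X k + Y k) / 2 - theta k * I k
  + theta k * (bx * Dx k + by_ * Dy k) / 2.
Proof. by rewrite /lyapunov invfM; ring. Qed.

(** The increment part of [I_le] cancels the last summand of [lyapunov]; what remains has
    coefficients [1 / tau k - ax] and [1 / tau k - ay], bounded below by [slack]. *)
Lemma lyapunov_ge k : eta / T / 2 * (X k + Y k) <= lyapunov k.
Proof.
have := slack (eta_x k); have := slack (eta_y k); have := I_le k.
rewrite lyapunovE.
have := X_ge0 k; have := Y_ge0 k; move: bx_ge0 by_ge0.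
move: ((tau k)^-1) (eta / T) => r c b1 b2 Y0 X0 HI hy hx.
have h1 : c * X k <= (r - ax) * X k by rewrite ler_wpM2r//; lra.
have h2 : c * Y k <= (r - ay) * Y k by rewrite ler_wpM2r//; lra.
lra.
Qed.

Lemma lyapunov_ge0 k : 0 <= lyapunov k.
Proof.
apply: le_trans (lyapunov_ge k).
by rewrite mulr_ge0 ?addr_ge0// !divr_ge0// ltW.
Qed.

Let weight k mu : tau k <= tau k.+1 * (theta k.+1 * (1 + mu * tau k)) ->
  (tau k.+1)^-1 <= theta k.+1 * ((1 + mu * tau k) / tau k).
Proof.
move=> h; rewrite -div1r ler_pdivrMr// mulrA mulrC mulrA ler_pdivlMr//.
by rewrite mul1r.
Qed.

Lemma lyapunov_descent k :
  lyapunov k.+1 + theta k.+1 * (eta / T / 2) * (Dx k.+1 + Dy k.+1) <= lyapunov k.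
Proof.
have t0 := tau_gt0 k; have th0 := theta_gt0 k.+1.
(* The contraction by [theta k.+1] is what the step sizes give; [theta k.+1 <= 1] and nonnegativity
   then discard the factor. *)
suff : lyapunov k.+1 + theta k.+1 * (eta / T / 2) * (Dx k.+1 + Dy k.+1)
       <= theta k.+1 * lyapunov k.
  move=> /le_trans; apply.
  by rewrite -[leRHS]mul1r ler_wpM2r// lyapunov_ge0.
have w1 := weight (tau_step1 k); have w2 := weight (tau_step2 k).
have hx := slack (eta_x k); have hy := slack (eta_y k).
have g0 : 0 <= tau k * gap k.+1 by rewrite mulr_ge0// ltW.
have st : ((1 + mu1 * tau k) / tau k * X k.+1 + (1 + mu2 * tau k) / tau k * Y k.+1
    + (tau k)^-1 * (Dx k.+1 + Dy k.+1)) / 2 - I k.+1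
    <= (tau k)^-1 * (X k + Y k) / 2 - theta k * I k - theta k * J k.
  rewrite -(ler_pM2l t0).
  have -> : tau k * (((1 + mu1 * tau k) / tau k * X k.+1 +
      (1 + mu2 * tau k) / tau k * Y k.+1
      + (tau k)^-1 * (Dx k.+1 + Dy k.+1)) / 2 - I k.+1) =
      (1 + mu1 * tau k) / 2 * X k.+1 + (1 + mu2 * tau k) / 2 * Y k.+1
      + (Dx k.+1 + Dy k.+1) / 2 - tau k * I k.+1 by field; rewrite gt_eqF.
  have -> : tau k * ((tau k)^-1 * (X k + Y k) / 2 - theta k * I k - theta k * J k)
    = (X k + Y k) / 2 - tau k * theta k * I k - tau k * theta k * J k.
    by field; rewrite gt_eqF.
  by have := step k; lra.
have HJ := J_le k.
rewrite !lyapunovE.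
move: st w1 w2 hx hy; move: ((1 + mu1 * tau k) / tau k) ((1 + mu2 * tau k) / tau k).
move: ((tau k.+1)^-1) ((tau k)^-1) (eta / T) => r' r c m1 m2 st w1 w2 hx hy.
have X0 := X_ge0 k.+1; have Y0 := Y_ge0 k.+1.
have h1 : r' * X k.+1 <= theta k.+1 * m1 * X k.+1 by rewrite ler_wpM2r.
have h2 : r' * Y k.+1 <= theta k.+1 * m2 * Y k.+1 by rewrite ler_wpM2r.
have h3 : c * Dx k.+1 <= (r - ax - bx) * Dx k.+1 by rewrite ler_wpM2r.
have h4 : c * Dy k.+1 <= (r - ay - by_) * Dy k.+1 by rewrite ler_wpM2r.
(* After [J_le] has used [ax] and [ay], the surplus in front of [Dx k.+1] and [Dy k.+1] splits in
   two: [bx], [by_] build the next [lyapunov] value, and [c] is the dissipated part. *)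
pose E := (m1 * X k.+1 + m2 * Y k.+1 + c * (Dx k.+1 + Dy k.+1)
   + bx * Dx k.+1 + by_ * Dy k.+1) / 2 - I k.+1.
have hE : E <= r * (X k + Y k) / 2 - theta k * I k
    + theta k * (bx * Dx k + by_ * Dy k) / 2 by rewrite /E; lra.
have := ler_wpM2l (ltW th0) hE.
by rewrite /E; lra.
Qed.

Lemma lyapunov_cvg : cvg (lyapunov @ \oo).
Proof.
apply: nonincreasing_is_cvgn.
  apply/nonincreasing_seqP => k; apply: le_trans (lyapunov_descent k).
  by rewrite lerDl mulr_ge0 ?addr_ge0// mulr_ge0 ?divr_ge0// ltW.
by exists 0 => _ [k _ <-]; exact: lyapunov_ge0.
Qed.

Lemma lyapunov_le0 k : lyapunov k <= lyapunov 0%N.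
Proof.
elim: k => // k; apply: le_trans; apply: le_trans (lyapunov_descent k).
by rewrite lerDl mulr_ge0 ?addr_ge0// mulr_ge0 ?divr_ge0// ltW.
Qed.

(** The increments are dominated by the differences of a convergent sequence; [rho] keeps the
    dissipation coefficient away from 0. *)
Lemma increments_cvg0 rho : 0 < rho -> (forall k, rho <= theta k) ->
  Dx k + Dy k @[k --> \oo] --> 0.
Proof.
move=> rho0 rhole.
rewrite -cvg_shiftS.
have c0 : 0 < eta / T / 2 by rewrite !divr_gt0.
apply: (@squeeze_cvgr _ _ _ _ (fun=> 0)
  (fun k => (lyapunov k - lyapunov k.+1) / (rho * (eta / T / 2)))).
- apply: nearW => k; rewrite addr_ge0//= (ler_pdivlMr _ _ (mulr_gt0 rho0 c0)).
  have := lyapunov_descent k.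
  have : rho * (eta / T / 2) * (Dx k.+1 + Dy k.+1) <=
         theta k.+1 * (eta / T / 2) * (Dx k.+1 + Dy k.+1).
    by rewrite ler_wpM2r ?addr_ge0// ler_wpM2r// ltW.
  lra.
- exact: cvg_cst.
- rewrite -[X in _ --> X](mul0r (rho * (eta / T / 2))^-1); apply: cvgMl.
  rewrite -(subrr (lim (lyapunov @ \oo))); apply: cvgB; first exact: lyapunov_cvg.
  by rewrite (cvg_shiftS lyapunov); exact: lyapunov_cvg.
Qed.

Lemma lyapunov_analysis rho : 0 < rho -> (forall k, rho <= theta k) ->
  [/\ forall k, eta / T / 2 * (X k + Y k) <= lyapunov 0%N,
    cvg (lyapunov @ \oo) & Dx k + Dy k @[k --> \oo] --> 0].
Proof.
move=> rho0 rhole; split.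
- by move=> k; apply: le_trans (lyapunov_ge k) (lyapunov_le0 k).
- exact: lyapunov_cvg.
- exact: increments_cvg0 rhole.
Qed.

End Lyapunov.

Lemma norm_le_cvg0 {R : realType} (C : R) (u v : nat -> R) :
  (forall k, `|u k| <= C * v k) -> v @ \oo --> 0 -> u @ \oo --> 0.
Proof.
move=> uv v0; apply/norm_cvg0P.
apply: (@squeeze_cvgr _ _ _ _ (fun=> 0) (fun k => C * v k)).
- by apply: nearW => k; rewrite normr_ge0 uv.
- exact: cvg_cst.
- by rewrite -[X in _ --> X](mulr0 C); apply: cvgMr.
Qed.

(** * Convergence of the iterates *)

Lemma prox_dom {R : realType} {H : hilbertType R} (mu tau : R) (f : H -> \bar R) u :
  0 <= mu -> 0 < tau -> proper_efun f -> lower_semicontinuous f ->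
  convex_with_modulus mu f -> prox (fun z => tau%:E * f z)%E u \in edom f.
Proof.
move=> mu0 tau0 fp fl fc; have [pfin _] := prox_growth u mu0 tau0 fp fl fc.
by rewrite inE /edom/= -(fineK pfin) ltry.
Qed.

Lemma epi_convex0 {R : realType} {H : hilbertType R} (mu : R) (g : H -> \bar R) :
  0 <= mu -> epi_convex mu g -> epi_convex 0 g.
Proof.
move=> mu0 gcvx u v a b t t01 gu gv; apply: le_trans (gcvx _ _ _ _ _ t01 gu gv) _.
have [t0 t1] : 0 <= t /\ 0 <= 1 - t by elra.
have h : 0 <= mu / 2 * (t * (1 - t) * `|u - v| ^+ 2).
  by rewrite mulr_ge0 ?divr_ge0// mulr_ge0 ?sqr_ge0// mulr_ge0.
by rewrite lee_fin; elra.
Qed.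

(** The lower bound comes from an upper bound on the reciprocals, which converge because the limit
    is nonzero. *)
Lemma cvg_gt0_bounds {R : realType} (u : nat -> R) (l : R) :
  0 < l -> (forall k, 0 < u k) -> u @ \oo --> l ->
  exists m M : R, 0 < m /\ forall k, m <= u k <= M.
Proof.
move=> l0 u0 ul.
have bnd (v : nat -> R) : cvg (v @ \oo) -> exists2 M, 0 < M & forall k, v k <= M.
  move=> /cvg_seq_bounded /pinfty_ex_gt0 [M M0 vM]; exists M => // k.
  exact: le_trans (ler_norm _) (vM k I).
have [M _ uM] := bnd u (cvgP _ ul).
have uVl : (fun k => (u k)^-1) @ \oo --> l^-1 by apply: cvgV; rewrite ?gt_eqF.
have [N N0 uN] := bnd _ (cvgP _ uVl).
exists N^-1, M; split=> [|k]; first by rewrite invr_gt0.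
by rewrite uM andbT -[u k]invrK lef_pV2 ?posrE ?invr_gt0.
Qed.

Lemma sqdistB_le {R : realType} {H : normedModType R} (K : R) (w w' c : H) :
  `|w - c| <= K -> `|w' - c| <= K ->
  `|w - c| ^+ 2 - `|w' - c| ^+ 2 <= 2 * K * `|w' - w|.
Proof.
move=> h h'; rewrite subr_sqr mulrC.
apply: (@le_trans _ _ ((`|w - c| + `|w' - c|) * `|w' - w|)).
  rewrite ler_wpM2l ?addr_ge0//; apply: le_trans (lerB_dist _ _) _.
  by rewrite opprB addrA subrK distrC.
by rewrite ler_wpM2r//; lra.
Qed.

Section Algorithm.
Context {R : realType} {H1 H2 : hilbertType R}.
Variables
  (Phi : H1 -> H2 -> \bar R) (f1 : H1 -> \bar R) (f2 : H2 -> \bar R)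
  (mu1 mu2 : R) (Lxx Lxy Lyx Lyy : R)
  (x : nat -> H1) (y : nat -> H2)
  (tau theta : nat -> R)
  (alpha beta gamma delta : nat -> R)
  (A : nat -> H1) (B : nat -> H2).
Hypotheses
  (mu1_ge0 : 0 <= mu1) (mu2_ge0 : 0 <= mu2)
  (f1_proper : proper_efun f1) (f2_proper : proper_efun f2)
  (f1_lsc : lower_semicontinuous f1) (f2_lsc : lower_semicontinuous f2)
  (f1_convex : convex_with_modulus mu1 f1)
  (f2_convex : convex_with_modulus mu2 f2)
  (Phix_fin : forall u v, v \in edom f2 -> Phi u v \is a fin_num)
  (Phix_convex : forall v, v \in edom f2 ->
     convex_function setT (fun u => fine (Phi u v)))
  (Phix_diff : forall u v, v \in edom f2 ->
     differentiable (fun u' => fine (Phi u' v)) u)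
  (Phiy_concave : forall u, u \in edom f1 ->
     convex_function setT (fun v => - fine (Phi u v)))
  (Phiy_diff : forall u v, u \in edom f1 ->
     differentiable (fun v' => fine (Phi u v')) v)
  (Lxx_ge0 : 0 <= Lxx) (Lxy_ge0 : 0 <= Lxy)
  (Lyx_ge0 : 0 <= Lyx) (Lyy_ge0 : 0 <= Lyy)
  (gradx_lip : forall u u' v v',
     u \in edom f1 -> u' \in edom f1 -> v \in edom f2 -> v' \in edom f2 ->
     `|gradx Phi u v - gradx Phi u' v'| <= Lxx * `|u - u'| + Lxy * `|v - v'|)
  (grady_lip : forall u u' v v',
     u \in edom f1 -> u' \in edom f1 -> v \in edom f2 -> v' \in edom f2 ->
     `|grady Phi u v - grady Phi u' v'| <= Lyx * `|u - u'| + Lyy * `|v - v'|)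
  (tau_gt0 : forall k, 0 < tau k) (theta_gt0 : forall k, 0 < theta k)
  (x0_dom : x 0%N \in edom f1) (y0_dom : y 0%N \in edom f2)
  (AE : forall k, A k = gradx Phi (x k) (y k))
  (BE : forall k, B k = grady Phi (x k) (y k))
  (x_step : forall k, x k.+1 =
     prox (fun u => (tau k)%:E * f1 u)%E
       (x k - tau k *: ((1 + theta k) *: A k - theta k *: A k.-1)))
  (y_step : forall k, y k.+1 =
     prox (fun v => (tau k)%:E * f2 v)%E
       (y k + tau k *: ((1 + theta k) *: B k - theta k *: B k.-1)))
  (theta_le1 : forall k, theta k <= 1) (theta0 : theta 0%N = 1)
  (tau_step1 : forall k, tau k <= tau k.+1 * (theta k.+1 * (1 + mu1 * tau k)))
  (tau_step2 : forall k, tau k <= tau k.+1 * (theta k.+1 * (1 + mu2 * tau k)))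
  (alpha_gt0 : forall k, 0 < alpha k) (beta_gt0 : forall k, 0 < beta k)
  (gamma_gt0 : forall k, 0 < gamma k) (delta_gt0 : forall k, 0 < delta k).
Variables (tau_lim m T ax bx ay by_ eta : R).
Hypotheses
  (tau_cvg : tau @ \oo --> tau_lim)
  (m_gt0 : 0 < m) (tau_ge : forall k, m <= tau k) (tau_le : forall k, tau k <= T)
  (eta_gt0 : 0 < eta)
  (ax_ge : forall k, Lxx * (theta k * alpha k) + Lxy * (theta k * beta k) <= ax)
  (bx_ge : forall k, Lxx / alpha k + Lyx / gamma k <= bx)
  (ay_ge : forall k, Lyx * (theta k * gamma k) + Lyy * (theta k * delta k) <= ay)
  (by_ge : forall k, Lxy / beta k + Lyy / delta k <= by_)
  (eta_x : forall k, tau k * (ax + bx) <= 1 - eta)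
  (eta_y : forall k, tau k * (ay + by_) <= 1 - eta).

Let dx k := `|x k - x k.-1|.
Let dy k := `|y k - y k.-1|.
(** The minus sign reflects the ascent in [y]. At [k = 0] the predecessor is 0 itself, so [dx],
    [dy], [I] and [J] all vanish there. *)
Let I u v k := inner (A k - A k.-1) (x k - u) - inner (B k - B k.-1) (y k - v).
Let J k := inner (A k - A k.-1) (x k.+1 - x k)
  - inner (B k - B k.-1) (y k.+1 - y k).
Let gap u v k := fine (f1 (x k)) + fine (Phi (x k) v) - fine (f2 v)
  - (fine (f1 u) + fine (Phi u (y k)) - fine (f2 (y k))).

(** * Domains of the iterates and the one-step estimate *)

Lemma x_dom k : x k \in edom f1.
Proof. by case: k => // k; rewrite x_step; exact: prox_dom f1_convex. Qed.

Lemma y_dom k : y k \in edom f2.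
Proof. by case: k => // k; rewrite y_step; exact: prox_dom f2_convex. Qed.

(** Add the two proximal inequalities. Convexity and concavity at the new point replace the linear
    terms in [A k.+1] and [B k.+1] by values of [Phi]; those at [(x k.+1, y k.+1)] cancel, leaving
    the gap. *)
Lemma one_step u v k : u \in edom f1 -> v \in edom f2 ->
  tau k * gap u v k.+1 + (1 + mu1 * tau k) / 2 * `|x k.+1 - u| ^+ 2
  + (1 + mu2 * tau k) / 2 * `|y k.+1 - v| ^+ 2 + (dx k.+1 ^+ 2 + dy k.+1 ^+ 2) / 2
  - tau k * I u v k.+1
  <= (`|x k - u| ^+ 2 + `|y k - v| ^+ 2) / 2
     - tau k * theta k * I u v k - tau k * theta k * J k.
Proof.
move=> u1 v2.
have hx : (f1 u <= (fine (f1 u))%:E)%E by rewrite -(edom_fin f1_proper u1).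
have hy : (f2 v <= (fine (f2 v))%:E)%E by rewrite -(edom_fin f2_proper v2).
have := prox_step (A k.+1) mu1_ge0 (tau_gt0 k) f1_proper f1_lsc f1_convex
  (x_step k) hx.
have := prox_step_ascent (B k.+1) mu2_ge0 (tau_gt0 k) f2_proper f2_lsc f2_convex
  (y_step k) hy.
have cx : 0 <= tau k * (fine (Phi u (y k.+1)) - fine (Phi (x k.+1) (y k.+1))
    + inner (A k.+1) (x k.+1 - u)).
  rewrite mulr_ge0 ?(ltW (tau_gt0 k))//.
  have := convex_gradient_le u (Phix_convex (y_dom k.+1))
    (Phix_diff (x k.+1) (y_dom k.+1)).
  by rewrite -(opprB (x k.+1)) innerNr AE /gradx; elra.
have cy : 0 <= tau k * (fine (Phi (x k.+1) (y k.+1)) - fine (Phi (x k.+1) v)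
    - inner (B k.+1) (y k.+1 - v)).
  rewrite mulr_ge0 ?(ltW (tau_gt0 k))//.
  have := concave_gradient_ge v (Phiy_concave (x_dom k.+1))
    (Phiy_diff (y k.+1) (x_dom k.+1)).
  by rewrite -(opprB (y k.+1)) innerNr BE /grady; elra.
rewrite /gap /I /J /dx /dy /=.
move: cx cy.
move: (inner (A k.+1) (x k.+1 - u)) (inner (B k.+1) (y k.+1 - v)).
move: (inner (A k.+1 - A k) _) (inner (B k.+1 - B k) _).
move: (inner (A k - A k.-1) (x k - u)) (inner (B k - B k.-1) (y k - v)).
move: (inner (A k - A k.-1) _) (inner (B k - B k.-1) _).
move: `|x k.+1 - u| `|y k.+1 - v| `|x k - u| `|y k - v| `|x k.+1 - x k| `|y k.+1 - y k|.
move: (fine (f1 (x k.+1))) (fine (f2 (y k.+1))) (fine (Phi (x k.+1) v)).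
move: (fine (Phi u (y k.+1))) (fine (Phi (x k.+1) (y k.+1))) (fine (f1 u)) (fine (f2 v)).
by clear hx hy; move: (tau k) (theta k) => t th *; lra.
Qed.

Lemma gradx_diff_le k : `|A k - A k.-1| <= Lxx * dx k + Lxy * dy k.
Proof. by rewrite !AE; apply: gradx_lip; rewrite ?x_dom ?y_dom. Qed.

Lemma grady_diff_le k : `|B k - B k.-1| <= Lyx * dx k + Lyy * dy k.
Proof. by rewrite !BE; apply: grady_lip; rewrite ?x_dom ?y_dom. Qed.

(** Stated with absolute values so as to serve both [I_le] and [J_le], whose pairings carry
    different signs. *)
Lemma cross_term_le k (w1 : H1) (w2 : H2) :
  theta k * (`|inner (A k - A k.-1) w1| + `|inner (B k - B k.-1) w2|) <=
  (ax * `|w1| ^+ 2 + ay * `|w2| ^+ 2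
   + theta k * (bx * dx k ^+ 2 + by_ * dy k ^+ 2)) / 2.
Proof.
apply: (@weighted_young _ Lxx Lxy Lyx Lyy (alpha k) (beta k) (gamma k) (delta k));
  rewrite ?(ltW (theta_gt0 k))//.
- by apply: le_trans (inner_norm_le _ _) _; rewrite ler_wpM2r// gradx_diff_le.
- by apply: le_trans (inner_norm_le _ _) _; rewrite ler_wpM2r// grady_diff_le.
Qed.

Lemma bx_ge0 : 0 <= bx.
Proof.
by apply: le_trans (bx_ge 0%N); rewrite addr_ge0// divr_ge0// ltW.
Qed.

Lemma by_ge0 : 0 <= by_.
Proof.
by apply: le_trans (by_ge 0%N); rewrite addr_ge0// divr_ge0// ltW.
Qed.

Lemma J_le k : - (theta k * J k) <=
  (ax * dx k.+1 ^+ 2 + ay * dy k.+1 ^+ 2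
   + theta k * (bx * dx k ^+ 2 + by_ * dy k ^+ 2)) / 2.
Proof.
apply: le_trans (cross_term_le k _ _); rewrite -mulrN ler_wpM2l ?(ltW (theta_gt0 k))//.
rewrite /J opprB addrC; apply: lerD; last exact: ler_norm.
by rewrite -normrN ler_norm.
Qed.

Lemma I_le u v k : theta k * I u v k <=
  (ax * `|x k - u| ^+ 2 + ay * `|y k - v| ^+ 2
   + theta k * (bx * dx k ^+ 2 + by_ * dy k ^+ 2)) / 2.
Proof.
apply: le_trans (cross_term_le k _ _); rewrite ler_wpM2l ?(ltW (theta_gt0 k))//.
rewrite /I; apply: lerD; first exact: ler_norm.
by rewrite -normrN ler_norm.
Qed.

Let S := saddle_point (objective f1 Phi f2).

Let X u k := `|x k - u| ^+ 2.
Let Y v k := `|y k - v| ^+ 2.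
Let Dx k := dx k ^+ 2.
Let Dy k := dy k ^+ 2.
Let V z := lyapunov tau theta (X z.1) (Y z.2) Dx Dy (I z.1 z.2) bx by_.

Lemma gap_ge0 z k : S z -> 0 <= gap z.1 z.2 k.
Proof.
move=> /(saddle_pointP f1_proper f2_proper Phix_fin)[z1 z2 zS].
by rewrite /gap subr_ge0 zS// ?x_dom// y_dom.
Qed.

(** The step rule gives [m <= tau k <= T * theta k.+1 * (1 + mu1 * T)]; index 0 is covered by
    [theta0]. *)
Lemma theta_ge : exists2 rho, 0 < rho & forall k, rho <= theta k.
Proof.
have T0 : 0 < T by exact: lt_le_trans (tau_gt0 0%N) (tau_le 0%N).
have mT : m <= T by exact: le_trans (tau_ge 0%N) (tau_le 0%N).
have q0 : 0 < T * (1 + mu1 * T) by rewrite mulr_gt0// ltr_wpDr// mulr_ge0// ltW.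
exists (m / (T * (1 + mu1 * T))) => [|[|k]]; first exact: divr_gt0.
  rewrite theta0 ler_pdivrMr// mul1r; apply: le_trans mT _.
  by rewrite ler_peMr ?(ltW T0)// lerDl mulr_ge0// ltW.
rewrite ler_pdivrMr//; apply: le_trans (tau_ge k) _.
apply: le_trans (tau_step1 k) _; rewrite mulrCA ler_wpM2l ?(ltW (theta_gt0 _))//.
apply: ler_pM; rewrite ?(ltW (tau_gt0 _)) ?tau_le//.
  by rewrite addr_ge0// mulr_ge0// ltW.
by rewrite lerD2l ler_wpM2l.
Qed.

Lemma saddle_analysis z : S z ->
  [/\ forall k, eta / T / 2 * (X z.1 k + Y z.2 k) <= V z 0%N,
    cvg (V z @ \oo) & Dx k + Dy k @[k --> \oo] --> 0].
Proof.
move=> zS; have [rho rho0 rhole] := theta_ge.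
have /(saddle_pointP f1_proper f2_proper Phix_fin)[z1 z2 _] := zS.
apply: (lyapunov_analysis tau_gt0 tau_le theta_gt0 theta_le1 tau_step1 tau_step2
  _ _ _ _ bx_ge0 by_ge0 eta_gt0 eta_x eta_y J_le (I_le z.1 z.2)
  (fun k => gap_ge0 k.+1 zS) (fun k => one_step k z1 z2) rho0 rhole) => k;
  exact: sqr_ge0.
Qed.

(** * Estimates at arbitrary points, resting on one fixed saddle point [z0] *)

Variable z0 : H1 * H2.
Hypothesis z0S : S z0.

Let d k := dx k + dy k.
Let L := Lxx + Lxy + Lyx + Lyy.

Let dx_ge0 k : 0 <= dx k. Proof. exact: normr_ge0. Qed.
Let dy_ge0 k : 0 <= dy k. Proof. exact: normr_ge0. Qed.
Let d_ge0 k : 0 <= d k. Proof. exact: addr_ge0. Qed.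
Let L_ge0 : 0 <= L. Proof. by rewrite /L !addr_ge0. Qed.

Lemma increments_norm_cvg0 : d @ \oo --> 0.
Proof.
have [_ _ /cvgrPdist_lt D0] := saddle_analysis z0S.
apply/cvgrPdist_lt => e e0; have e20 : 0 < e / 2 by rewrite divr_gt0.
have := D0 ((e / 2) ^+ 2) (exprn_gt0 _ e20); apply: filterS => k.
rewrite !sub0r !normrN !ger0_norm ?addr_ge0 ?sqr_ge0// => h.
have lt1 (a : R) : 0 <= a -> a ^+ 2 < (e / 2) ^+ 2 -> a < e / 2.
  by move=> a0; rewrite ltr_pXn2r// nnegrE// ltW.
have h1 : dx k < e / 2.
  by apply: lt1 => //; apply: le_lt_trans h; rewrite lerDl sqr_ge0.
have h2 : dy k < e / 2.
  by apply: lt1 => //; apply: le_lt_trans h; rewrite lerDr sqr_ge0.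
by rewrite /d; lra.
Qed.

Lemma iterates_bounded u v :
  exists K, forall k, `|x k - u| <= K /\ `|y k - v| <= K.
Proof.
have [bnd _ _] := saddle_analysis z0S.
have T0 : 0 < T by exact: lt_le_trans (tau_gt0 0%N) (tau_le 0%N).
have c0 : 0 < eta / T / 2 by rewrite !divr_gt0.
pose Q := V z0 0%N / (eta / T / 2).
have {}bnd k : X z0.1 k + Y z0.2 k <= Q by rewrite ler_pdivlMr// mulrC.
(* A crude bound that avoids square roots, from [(a - 1)^2 >= 0]. *)
have le1 (a : R) : a ^+ 2 <= Q -> a <= 1 + Q.
  by move=> h; have := sqr_ge0 (a - 1); have := sqr_ge0 a; rewrite sqrrB; lra.
exists (1 + Q + `|z0.1 - u| + `|z0.2 - v|) => k; split.
  have -> : x k - u = (x k - z0.1) + (z0.1 - u) by rewrite addrA subrK.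
  apply: le_trans (ler_normD _ _) _; rewrite -addrA lerD// ?lerDl//.
  by apply: le1; apply: le_trans (bnd k); rewrite lerDl sqr_ge0.
have -> : y k - v = (y k - z0.2) + (z0.2 - v) by rewrite addrA subrK.
apply: le_trans (ler_normD _ _) _; rewrite lerD// -[leLHS]addr0 lerD//.
by apply: le1; apply: le_trans (bnd k); rewrite lerDr sqr_ge0.
Qed.

Let A_le k : `|A k - A k.-1| <= L * d k.
Proof.
apply: le_trans (gradx_diff_le k) _; rewrite /L /d mulrDr.
by rewrite lerD// ler_wpM2r//; move: Lxx_ge0 Lxy_ge0 Lyx_ge0 Lyy_ge0; lra.
Qed.

Let B_le k : `|B k - B k.-1| <= L * d k.
Proof.
apply: le_trans (grady_diff_le k) _; rewrite /L /d mulrDr.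
by rewrite lerD// ler_wpM2r//; move: Lxx_ge0 Lxy_ge0 Lyx_ge0 Lyy_ge0; lra.
Qed.

Let inner_diff_le k K (w1 : H1) (w2 : H2) : `|w1| <= K -> `|w2| <= K ->
  `|inner (A k - A k.-1) w1 - inner (B k - B k.-1) w2| <= 2 * K * (L * d k).
Proof.
move=> w1K w2K; apply: le_trans (ler_normB _ _) _.
have -> : 2 * K * (L * d k) = L * d k * K + L * d k * K by ring.
by apply: lerD; apply: le_trans (inner_norm_le _ _) _; apply: ler_pM.
Qed.

(** For arbitrary [(u, v)] the gap has no sign, so [one_step] is read as an upper bound on it:
    boundedness makes the differences of squared distances and the pairings linear in the
    increments. *)
Lemma gap_le u v : u \in edom f1 -> v \in edom f2 ->
  exists C, forall k, gap u v k.+1 <= C * (d k + d k.+1).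
Proof.
move=> u1 v2; have [K Kb] := iterates_bounded u v.
have K0 : 0 <= K by have [h _] := Kb 0%N; exact: le_trans h.
have T0 : 0 < T by exact: lt_le_trans (tau_gt0 0%N) (tau_le 0%N).
(* [K / m] comes from the squared distances after division by [tau k >= m]. In [6 * K * L], the
   pairing [I] at [k] contributes 2 and [J] contributes 4, its vectors being bounded by [2 * K]; [I]
   at [k.+1] needs only 2, and [W0] pads the rest. *)
exists (K / m + 6 * K * L) => k.
have [xk yk] := Kb k; have [xk1 yk1] := Kb k.+1.
have t0 := tau_gt0 k.
have hI := inner_diff_le k xk yk.
have hI1 := inner_diff_le k.+1 xk1 yk1.
have dle : `|x k.+1 - x k| <= 2 * K /\ `|y k.+1 - y k| <= 2 * K.
  split.
    have -> : x k.+1 - x k = (x k.+1 - u) - (x k - u) by rewrite opprB addrA subrK.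
    by apply: le_trans (ler_normB _ _) _; lra.
  have -> : y k.+1 - y k = (y k.+1 - v) - (y k - v) by rewrite opprB addrA subrK.
  by apply: le_trans (ler_normB _ _) _; lra.
have hJ := inner_diff_le k dle.1 dle.2.
have sx := sqdistB_le xk xk1; have sy := sqdistB_le yk yk1.
have st := one_step k u1 v2.
have e1 : 0 <= (mu1 * tau k) / 2 * `|x k.+1 - u| ^+ 2.
  by rewrite mulr_ge0 ?sqr_ge0// divr_ge0// mulr_ge0// ltW.
have e2 : 0 <= (mu2 * tau k) / 2 * `|y k.+1 - v| ^+ 2.
  by rewrite mulr_ge0 ?sqr_ge0// divr_ge0// mulr_ge0// ltW.
have e3 : 0 <= (dx k.+1 ^+ 2 + dy k.+1 ^+ 2) / 2.
  by rewrite divr_ge0// addr_ge0// sqr_ge0.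
have i1 : tau k * I u v k.+1 <= tau k * (2 * K * (L * d k.+1)).
  by rewrite ler_wpM2l ?(ltW t0)//; exact: le_trans (ler_norm _) hI1.
have thle (a b : R) : `|a| <= b -> - (tau k * theta k * a) <= tau k * b.
  move=> ab; rewrite -mulrA -mulrN ler_wpM2l ?(ltW t0)// -mulrN.
  apply: le_trans (ler_norm _) _; rewrite normrM normrN (gtr0_norm (theta_gt0 k)).
  by apply: le_trans ab; rewrite ler_piMl.
have i2 := thle _ _ hI; have i3 := thle _ _ hJ.
have dE : d k.+1 = `|x k.+1 - x k| + `|y k.+1 - y k| by [].
have tg : tau k * gap u v k.+1 <= K * d k.+1 + tau k * (6 * K * L * (d k + d k.+1)).
  have W0 : 0 <= tau k * (4 * K * L * d k.+1) by rewrite !mulr_ge0// ltW.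
  move: st sx sy i1 i2 i3 e1 e2 e3 W0; rewrite -/(I u v k) -/(J k) dE.
  move: (I u v k) (I u v k.+1) (J k) (gap u v k.+1) (d k).
  move: (dx k.+1 ^+ 2 + dy k.+1 ^+ 2).
  move: `|x k.+1 - u| `|y k.+1 - v| `|x k - u| `|y k - v| `|x k.+1 - x k| `|y k.+1 - y k|.
  by move: (tau k) (theta k) => *; lra.
have tK : K * d k.+1 <= tau k * (K / m * (d k + d k.+1)).
  have h : K <= tau k * (K / m).
    by rewrite mulrA ler_pdivlMr// mulrC ler_wpM2r.
  apply: (@le_trans _ _ (tau k * (K / m) * d k.+1)); first by rewrite ler_wpM2r.
  by rewrite -mulrA ler_wpM2l ?(ltW t0)// ler_wpM2l ?divr_ge0 ?(ltW m_gt0)// lerDr.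
by rewrite -(ler_pM2l t0); move: tg tK; rewrite mulrDl mulrDr; lra.
Qed.

(** Solve the definition of [V] for the squared distances. The pairing and increment terms tend to
    0, and the common step size converges, so the factor [2 * tau k] has a limit. *)
Lemma distance_cvg z : S z -> cvg (X z.1 k + Y z.2 k @[k --> \oo]).
Proof.
move=> zS; have [_ Vcvg D0] := saddle_analysis zS.
have [K Kb] := iterates_bounded z.1 z.2.
pose r k := theta k * I z.1 z.2 k; pose s k := theta k * (bx * Dx k + by_ * Dy k) / 2.
have r0 : r @ \oo --> 0.
  apply: (@norm_le_cvg0 _ (2 * K * L) _ d _ increments_norm_cvg0) => k.
  rewrite normrM (gtr0_norm (theta_gt0 k)).
  have [xk yk] := Kb k; have h := inner_diff_le k xk yk.
  by rewrite -[leRHS]mulrA; apply: le_trans h; rewrite ler_piMl.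
have s0 : s @ \oo --> 0.
  apply: (@norm_le_cvg0 _ (bx + by_) _ (fun k => Dx k + Dy k) _ D0) => k.
  have [p1 p2] : 0 <= Dx k /\ 0 <= Dy k by rewrite !sqr_ge0.
  have b1 := mulr_ge0 bx_ge0 p1; have b2 := mulr_ge0 by_ge0 p2.
  have b3 := mulr_ge0 bx_ge0 p2; have b4 := mulr_ge0 by_ge0 p1.
  have h : theta k * (bx * Dx k + by_ * Dy k) <= bx * Dx k + by_ * Dy k.
    by rewrite ler_piMl// addr_ge0.
  rewrite ger0_norm; last by rewrite divr_ge0// mulr_ge0 ?addr_ge0// ltW.
  by rewrite /s; lra.
have -> : (fun k => X z.1 k + Y z.2 k) = (fun k => 2 * tau k * (V z k + r k - s k)).
  apply/funext => k; rewrite /V /lyapunov -/(r k) -/(s k).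
  by field; rewrite gt_eqF.
move: r0 s0 Vcvg; move: (V z) r s => W r s r0 s0 Wcvg.
apply/cvg_ex; exists (2 * tau_lim * (lim (W @ \oo) + 0 - 0)).
by apply: cvgM; [apply: cvgMr|apply: cvgB; [apply: cvgD|]].
Qed.

(** In [key] the saddle inequality is rearranged so that each summand on the left depends on one
    coordinate of [z] only and is convex and lower semicontinuous in it. Weak limits can then be
    taken separately. *)
Lemma cluster_saddle (F : set_system nat) z : ProperFilter F -> \oo `<=` F ->
  filter_wcvg F x z.1 -> filter_wcvg F y z.2 -> S z.
Proof.
move=> FF Foo xz yz.
have key u v : u \in edom f1 -> v \in edom f2 ->
  ((f1 z.1 + (fine (Phi z.1 v))%:E) + (f2 z.2 + (- fine (Phi u z.2))%:E)
    <= (fine (f1 u) + fine (f2 v))%:E)%E.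
  move=> u1 v2.
  have h1cvx : epi_convex 0 (fun w => f1 w + (fine (Phi w v))%:E)%E.
    rewrite -(addr0 0); apply: epi_convexD.
      exact: epi_convex0 mu1_ge0 (epi_convexW f1_proper.1 f1_convex).
    by apply: convex_function_epi; exact: Phix_convex.
  have h2cvx : epi_convex 0 (fun w => f2 w + (- fine (Phi u w))%:E)%E.
    rewrite -(addr0 0); apply: epi_convexD.
      exact: epi_convex0 mu2_ge0 (epi_convexW f2_proper.1 f2_convex).
    by apply: convex_function_epi; exact: Phiy_concave.
  have h1lsc : lower_semicontinuous (fun w => f1 w + (fine (Phi w v))%:E)%E.
    apply: lower_semicontinuousD => // w.
    exact: differentiable_continuous (Phix_diff w v2).
  have h2lsc : lower_semicontinuous (fun w => f2 w + (- fine (Phi u w))%:E)%E.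
    apply: lower_semicontinuousD => // w; apply: cvgN.
    exact: differentiable_continuous (Phiy_diff w u1).
  apply: adde_le_fin => [| |a1 a2 a1z a2z].
  - by have := f1_proper.1 z.1; case: (f1 z.1).
  - by have := f2_proper.1 z.2; case: (f2 z.2).
  apply/ler_addgt0Pr => e e0.
  have g1 := @weak_lower_semicontinuous _ _ _ F FF _ _ _ _ h1cvx h1lsc xz a1z.
  have g2 := @weak_lower_semicontinuous _ _ _ F FF _ _ _ _ h2cvx h2lsc yz a2z.
  have g3 : \forall k \near F, gap u v k <= e.
    apply: Foo; have [C gC] := gap_le u1 v2.
    have lim0 : C * (d k + d k.+1) @[k --> \oo] --> 0.
      rewrite -[X in _ --> X](mulr0 C); apply: cvgMr; rewrite -(addr0 0).
      apply: cvgD; first exact: increments_norm_cvg0.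
      by rewrite (cvg_shiftS d); exact: increments_norm_cvg0.
    have : \forall k \near \oo, gap u v k.+1 <= e.
      have : \forall k \near \oo, C * (d k + d k.+1) <= e by apply: cvgr_le e0.
      by apply: filterS => k; exact: le_trans.
    (* [gap_le] speaks of [k.+1], hence the threshold moves by one. *)
    by move=> [N _ NP]; exists N.+1 => // -[|k]// Nk; exact: NP.
  have [k [[+ +] +]] := filter_ex (filterI (filterI g1 g2) g3).
  rewrite /= (edom_fin f1_proper (x_dom k)) (edom_fin f2_proper (y_dom k)).
  by rewrite -!EFinD !lte_fin /gap; lra.
have [u0 /mem_set u0d] := f1_proper.2; have [v0 /mem_set v0d] := f2_proper.2.
(* A single comparison point already bounds the sum by a real number, so neither [f1 z.1] nor
   [f2 z.2] is [+oo]. *)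
have [z1 z2] : z.1 \in edom f1 /\ z.2 \in edom f2.
  have := key _ _ u0d v0d; rewrite !inE /edom/=.
  have := f1_proper.1 z.1; have := f2_proper.1 z.2.
  by case: (f1 z.1) => [r1| |]//; case: (f2 z.2) => [r2| |]//; rewrite !ltry.
apply/(saddle_pointP f1_proper f2_proper Phix_fin); split=> // u v u1 v2.
have := key _ _ u1 v2.
rewrite (edom_fin f1_proper z1) (edom_fin f2_proper z2) -!EFinD lee_fin.
lra.
Qed.

Lemma algorithm_weak_cvg : exists2 z, S z & weakly_cvg (fun k => (x k, y k)) z.
Proof.
have [K Kb] := iterates_bounded 0 0.
apply: (@opial _ _ _ x y S K).
- by move=> k; rewrite -[x k]subr0; have [] := Kb k.
- by move=> k; rewrite -[y k]subr0; have [] := Kb k.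
- by move=> z zS; exact: distance_cvg.
- by move=> F FF Foo z; exact: cluster_saddle.
Qed.

End Algorithm.

(** * From the extended-real step-size conditions to the algorithm with real constants *)

Theorem theorem3p13
  (R : realType) (H1 H2 : hilbertType R)
  (Phi : H1 -> H2 -> \bar R) (f1 : H1 -> \bar R) (f2 : H2 -> \bar R)
  (mu1 mu2 : R) (Lxx Lxy Lyx Lyy : R)
  (x : nat -> H1) (y : nat -> H2)
  (tau sigma lambda theta : nat -> R)
  (alpha beta gamma delta : nat -> R)
  (mu1_ge0 : 0 <= mu1) (mu2_ge0 : 0 <= mu2)
  (f1_proper : proper_efun f1) (f2_proper : proper_efun f2)
  (f1_lsc : lower_semicontinuous f1) (f2_lsc : lower_semicontinuous f2)
  (f1_convex : convex_with_modulus mu1 f1)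
  (f2_convex : convex_with_modulus mu2 f2)
  (dom1_neq0 : edom f1 !=set0) (dom2_neq0 : edom f2 !=set0)
  (dom1_closed : closed (edom f1)) (dom2_closed : closed (edom f2))
  (dom1_convex : convex_set (edom f1)) (dom2_convex : convex_set (edom f2))
  (Phix_fin : forall u v, v \in edom f2 -> Phi u v \is a fin_num)
  (Phix_convex : forall v, v \in edom f2 ->
     convex_function setT (fun u => fine (Phi u v)))
  (Phix_diff : forall u v, v \in edom f2 ->
     differentiable (fun u' => fine (Phi u' v)) u)
  (Phiy_fin : forall u v, u \in edom f1 -> Phi u v \is a fin_num)
  (Phiy_concave : forall u, u \in edom f1 ->
     convex_function setT (fun v => - fine (Phi u v)))
  (Phiy_diff : forall u v, u \in edom f1 ->
     differentiable (fun v' => fine (Phi u v')) v)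
  (Lxx_ge0 : 0 <= Lxx) (Lxy_ge0 : 0 <= Lxy)
  (Lyx_ge0 : 0 <= Lyx) (Lyy_ge0 : 0 <= Lyy)
  (gradx_lip : forall u u' v v',
     u \in edom f1 -> u' \in edom f1 -> v \in edom f2 -> v' \in edom f2 ->
     `|gradx Phi u v - gradx Phi u' v'| <= Lxx * `|u - u'| + Lxy * `|v - v'|)
  (grady_lip : forall u u' v v',
     u \in edom f1 -> u' \in edom f1 -> v \in edom f2 -> v' \in edom f2 ->
     `|grady Phi u v - grady Phi u' v'| <= Lyx * `|u - u'| + Lyy * `|v - v'|)
  (* [k.-1] is 0 for k = 0, so that x^{-1} = x^0, y^{-1} = y^0 *)
  (tau_gt0 : forall k, 0 < tau k) (sigma_gt0 : forall k, 0 < sigma k)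
  (lambda_gt0 : forall k, 0 < lambda k) (theta_gt0 : forall k, 0 < theta k)
  (x0_dom : x 0%N \in edom f1) (y0_dom : y 0%N \in edom f2)
  (x_step : forall k, x k.+1 =
     prox (fun u => (tau k)%:E * f1 u)%E
       (x k - tau k *: ((1 + lambda k) *: gradx Phi (x k) (y k)
                        - lambda k *: gradx Phi (x k.-1) (y k.-1))))
  (y_step : forall k, y k.+1 =
     prox (fun v => (sigma k)%:E * f2 v)%E
       (y k + sigma k *: ((1 + theta k) *: grady Phi (x k) (y k)
                          - theta k *: grady Phi (x k.-1) (y k.-1))))
  (saddle_ex : exists z, saddle_point (objective f1 Phi f2) z)
  (lambda_theta : forall k, lambda k = theta k)
  (theta_le1 : forall k, theta k <= 1)
  (lambda0 : lambda 0%N = 1) (theta0 : theta 0%N = 1)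
  (tau_step : forall k,
     tau k.+1 >= tau k / (theta k.+1 * (1 + mu1 * tau k)))
  (sigma_step : forall k,
     sigma k.+1 >= sigma k / (theta k.+1 * (1 + mu2 * sigma k)))
  (tau_sigma : forall k, tau k = sigma k)
  (tau_sigma_lim : exists t : R,
     [/\ 0 < t, tau @ \oo --> t & sigma @ \oo --> t])
  (alpha_gt0 : forall k, 0 < alpha k) (beta_gt0 : forall k, 0 < beta k)
  (gamma_gt0 : forall k, 0 < gamma k) (delta_gt0 : forall k, 0 < delta k) :
  let eta_x : \bar R :=
    (1 - esup tau *
         (Lxx%:E * esup (fun k => lambda k * alpha k)%R
          + Lxy%:E * esup (fun k => lambda k * beta k)%R
          + Lxx%:E / einf alpha + Lyx%:E / einf gamma))%E in
  let eta_y : \bar R :=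
    (1 - esup sigma *
         (Lyx%:E * esup (fun k => theta k * gamma k)%R
          + Lyy%:E * esup (fun k => theta k * delta k)%R
          + Lxy%:E / einf beta + Lyy%:E / einf delta))%E in
  (0 < eta_x < +oo)%E -> (0 < eta_y < +oo)%E ->
  exists2 z : H1 * H2, saddle_point (objective f1 Phi f2) z
    & weakly_cvg (fun k => (x k, y k)) z.
Proof.
have lE : lambda = theta by exact/funext.
have sE : sigma = tau by apply/funext => k.
subst lambda sigma => eta_x eta_y /andP[eta_x0 _] /andP[eta_y0 _].
have [t [t0 taut _]] := tau_sigma_lim.
have [m [T [m0 mT]]] := cvg_gt0_bounds t0 tau_gt0 taut.
have pos (p : nat -> R) : (forall k, 0 < p k) -> forall k, 0 < theta k * p k.
  by move=> p0 k; rewrite mulr_gt0.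
have [ax [bx [etax [etax0 hax hbx hetax]]]] := step_size_constants Lxx_ge0 Lxy_ge0
  Lxx_ge0 Lyx_ge0 tau_gt0 (pos _ alpha_gt0) (pos _ beta_gt0) alpha_gt0 gamma_gt0
  eta_x0.
have [ay [by_ [etay [etay0 hay hby hetay]]]] := step_size_constants Lyx_ge0 Lyy_ge0
  Lxy_ge0 Lyy_ge0 tau_gt0 (pos _ gamma_gt0) (pos _ delta_gt0) beta_gt0 delta_gt0
  eta_y0.
have stepM mu : 0 <= mu ->
    (forall k, tau k.+1 >= tau k / (theta k.+1 * (1 + mu * tau k))) ->
    forall k, tau k <= tau k.+1 * (theta k.+1 * (1 + mu * tau k)).
  move=> mu0 h k; rewrite -ler_pdivrMr//.
  by rewrite mulr_gt0// ltr_wpDr// mulr_ge0// ltW.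
have [z zS] := saddle_ex.
(* The Lyapunov estimates use one margin for both variables, so the smaller one is taken. *)
have [etaxy etayx] : Num.min etax etay <= etax /\ Num.min etax etay <= etay.
  by rewrite !ge_min !lexx orbT.
apply: (@algorithm_weak_cvg R H1 H2 Phi f1 f2 mu1 mu2 Lxx Lxy Lyx Lyy x y tau theta
  alpha beta gamma delta (fun k => gradx Phi (x k) (y k))
  (fun k => grady Phi (x k) (y k))
  mu1_ge0 mu2_ge0 f1_proper f2_proper f1_lsc f2_lsc f1_convex f2_convex
  Phix_fin Phix_convex Phix_diff Phiy_concave Phiy_diff
  Lxx_ge0 Lxy_ge0 Lyx_ge0 Lyy_ge0 gradx_lip grady_lip tau_gt0 theta_gt0
  x0_dom y0_dom (fun=> erefl) (fun=> erefl) x_step y_step theta_le1 theta0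
  (stepM _ mu1_ge0 tau_step) (stepM _ mu2_ge0 sigma_step)
  alpha_gt0 beta_gt0 gamma_gt0 delta_gt0
  t m T ax bx ay by_ (Num.min etax etay) taut m0 _ _ _ hax hbx hay hby _ _ z zS).
- by move=> k; have /andP[] := mT k.
- by move=> k; have /andP[] := mT k.
- by rewrite lt_min etax0.
- by move=> k; apply: le_trans (hetax k) _; rewrite lerD2l lerN2.
- by move=> k; apply: le_trans (hetay k) _; rewrite lerD2l lerN2.
Qed.
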